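(* The operators $L, L^+ \colon \mathfrak H_0 \to \mathfrak H$ have the following properties: (a) $L$ and $L^+$ are essentially skew-adjoint on $\mathfrak H_0$. (b) For every $n \in \mathbb N$, every integer $k$ with $0 \le k < n$, and every $f \in \mathcal H_\infty$, $$(p_1 \otimes \mathrm{Id}) L^k E_n f = V^k f, \qquad (p_1 \otimes \mathrm{Id}) (L^+)^k E_n f = (V^* )^k f.$$
   Context: Setting. $X$ is a $C^\infty$ manifold and $\Phi^t \colon X \to X$, $t \in \mathbb R$, is a flow generated by a $C^\infty$ vector field $\vec V \colon X \to TX$, with associated derivation $V \colon C^\infty(X) \to C^\infty(X)$, $Vf = \vec V \cdot \nabla f$. $\mathcal H \subset C^\infty(X)$ is a complex reproducing kernel Hilbert space (RKHS) with strictly positive-definite kernel $k \colon X \times X \to \mathbb C$ and kernel sections $k_x = k(x,\cdot)$, so $f(x) = \langle k_x, f\rangle_{\mathcal H}$ (inner products are conjugate-linear in the first argument). As an unbounded operator on $\mathcal H$, $V$ has domain $\mathrm{dom}(V) = \{f \in \mathcal H : Vf \in \mathcal H\}$; $V^*$ is its adjoint. Standing assumption. (a) $V$ is continuous as a map from $\mathcal H$ to $C(X)$ with the compact-open topology. (b) $\mathcal H_\infty \subseteq \mathrm{dom}(V) \cap \mathrm{dom}(V^* )$ is a dense subspace of $\mathcal H$ with $V(\mathcal H_\infty) \subseteq \mathcal H_\infty$ and $V^*(\mathcal H_\infty) \subseteq \mathcal H_\infty$. (c) $V$ and $V^*$ are jointly analytic on $\mathcal H_\infty$: with $V_1 = V$,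 $V_2 = V^*$, for every $f \in \mathcal H_\infty$ there is $R_f > 0$ such that $\sum_{n=0}^\infty \frac{z^n}{n!} \sum_{\epsilon \colon [n] \to [2]} \lVert V_{\epsilon(1)} \cdots V_{\epsilon(n)} f \rVert_{\mathcal H}$ converges for $|z| < R_f$, where $[n] = \{1,\dots,n\}$. Amplification. $A = (V - V^* )/2$ and $S = (V+V^* )/2$ on $\mathcal H_\infty$. $\mathfrak H = \ell^2(\mathbb N) \otimes \mathcal H$, $\mathfrak H_0 = C_c(\mathbb N) \otimes_{\mathrm{alg}} \mathcal H_\infty$ ($C_c(\mathbb N)$ the finitely supported sequences), $e_1, e_2, \dots$ is the canonical orthonormal basis of $\ell^2(\mathbb N)$, and $e_{i,j}$ are the matrix units, $e_{i,j} e_j = e_i$. On $\mathfrak H_0$, $$L = \sum_{i=1}^\infty \left(e_{i,i+1} \otimes S + e_{i,i} \otimes A - e_{i+1,i} \otimes S\right), \qquad L^+ = \sum_{i=1}^\infty \left(e_{i,i+1} \otimes S - e_{i,i} \otimes A - e_{i+1,i} \otimes S\right).$$ $F_n$ is the $n$-th Fibonacci number ($F_0 = 0$, $F_1 = 1$, $F_n = F_{n-1}+F_{n-2}$), $E_n \colon \mathcal H \to \mathfrak H$ is $E_n f = \sum_{i=1}^n F_i\, e_i \otimes f$, and $p_1 \colon \ell^2(\mathbb N) \to \mathbb C$ is the projection onto the first component, so $p_1 \otimes \mathrm{Id} \colon \mathfrak H \to \mathcal H$. A densely defined antisymmetric operator is essentially skew-adjoint if its closure is skew-adjoint. *)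

(* Defs.v *)
From HB Require Import structures.
From mathcomp Require Import all_boot all_order all_algebra.
From mathcomp Require Import complex.
From mathcomp Require Import all_classical all_reals all_analysis.

Set Implicit Arguments.
Unset Strict Implicit.
Unset Printing Implicit Defensive.

Import Order.TTheory GRing.Theory Num.Theory.
Import numFieldNormedType.Exports.

Local Open Scope classical_set_scope.
Local Open Scope complex_scope.
Local Open Scope ring_scope.

Section Manifold.
Context {R : realType}.

Fixpoint Ck_on (V W : normedModType R) (k : nat) (U : set V) (f : V -> W) : Prop :=
  match k with
  | 0 => forall x, U x -> {for x, continuous f}
  | k'.+1 => (forall x, U x -> differentiable f x) /\
             (forall v : V, Ck_on k' U ('D_v f))
  end.

(* Meant for open U: continuity and differentiability are taken in the ambient space. *)
Definition smooth_on (V W : normedModType R) (U : set V) (f : V -> W) : Prop :=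
  forall k, Ck_on k U f.

Record chart (d : nat) (X : topologicalType) := Chart {
  chart_dom : set X;
  chart_map : X -> 'rV[R]_d;
  chart_inv : 'rV[R]_d -> X }.

Definition chart_img d (X : topologicalType) (c : chart d X) : set 'rV[R]_d :=
  chart_map c @` chart_dom c.

(* A homeomorphism from an open subset of X onto an open subset of R^d. *)
Definition is_chart d (X : topologicalType) (c : chart d X) : Prop :=
  [/\ open (chart_dom c), open (chart_img c),
      forall x, chart_dom c x -> chart_inv c (chart_map c x) = x,
      {within chart_dom c, continuous (chart_map c)} &
      {within chart_img c, continuous (chart_inv c)}].

Definition smooth_atlas d (X : topologicalType) (A : set (chart d X)) : Prop :=
  [/\ forall c, A c -> is_chart c,
      forall x, exists2 c, A c & chart_dom c x &
      forall c c', A c -> A c' ->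
        smooth_on (chart_map c @` (chart_dom c `&` chart_dom c'))
                  (chart_map c' \o chart_inv c)].

Definition smooth_manifold d (X : topologicalType) (A : set (chart d X)) : Prop :=
  [/\ hausdorff_space X, @second_countable X & smooth_atlas A].

Definition smoothR d (X : topologicalType) (A : set (chart d X)) (f : X -> R) : Prop :=
  forall c, A c -> smooth_on (chart_img c) (f \o chart_inv c).

Definition smoothC d (X : topologicalType) (A : set (chart d X)) (f : X -> R[i]) : Prop :=
  smoothR A (fun x => complex.Re (f x)) /\ smoothR A (fun x => complex.Im (f x)).

(* Elements of the tangent space at x, as derivations at x of the algebra of
   smooth real functions; values on non-smooth functions are irrelevant. *)
Definition tangent_vector d (X : topologicalType) (A : set (chart d X)) (x : X)
    (v : (X -> R) -> R) : Prop :=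
  (forall (a : R) f g, smoothR A f -> smoothR A g ->
     v (fun y => a * f y + g y) = a * v f + v g) /\
  (forall f g, smoothR A f -> smoothR A g ->
     v (fun y => f y * g y) = v f * g x + f x * v g).

Definition smooth_vector_field d (X : topologicalType) (A : set (chart d X))
    (v : X -> (X -> R) -> R) : Prop :=
  (forall x, tangent_vector A x (v x)) /\
  (forall f, smoothR A f -> smoothR A (fun x => v x f)).

Definition flow_generated_by d (X : topologicalType) (A : set (chart d X))
    (v : X -> (X -> R) -> R) (Phi : R -> X -> X) : Prop :=
  [/\ forall x, Phi 0 x = x,
      forall s t x, Phi (s + t) x = Phi s (Phi t x) &
      forall f, smoothR A f -> forall x t,
        is_derive t (1 : R) (fun s => f (Phi s x)) (v (Phi t x) f)].

(* v . grad f, extended complex-linearly. *)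
Definition derivation (X : Type) (v : X -> (X -> R) -> R) (f : X -> R[i]) : X -> R[i] :=
  fun x => v x (fun y => complex.Re (f y)) +i* v x (fun y => complex.Im (f y)).

End Manifold.

Section HilbertSpaces.
Context {R : realType}.
Local Notation C := R[i].

(* A linear subspace of an ambient vector space E together with an inner
   product; ip is only meaningful on the carrier. *)
Record ipspace (E : lmodType C) := IPSpace {
  carrier :> E -> Prop;
  ip : E -> E -> C }.

Definition linear_subspace (E : lmodType C) (D : set E) : Prop :=
  D 0 /\ forall (a : C) f g, D f -> D g -> D (a *: f + g).

Definition hnorm (E : lmodType C) (H : ipspace E) (f : E) : R :=
  Num.sqrt (complex.Re (ip H f f)).

Definition hcvg (E : lmodType C) (H : ipspace E) (u : nat -> E) (l : E) : Prop :=
  H l /\ (fun n => hnorm H (u n - l)) @ \oo --> (0 : R).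

Definition is_hilbert (E : lmodType C) (H : ipspace E) : Prop :=
  [/\ linear_subspace (carrier H),
      forall f g h (a : C), H f -> H g -> H h ->
        ip H f (a *: g + h) = a * ip H f g + ip H f h,
      forall f g, H f -> H g -> ip H g f = (ip H f g)^*%C,
      forall f, H f -> f != 0 -> 0 < ip H f f &
      forall u : nat -> E, (forall n, H (u n)) ->
        (forall e : R, 0 < e -> exists N, forall m n, (N <= m)%N -> (N <= n)%N ->
           hnorm H (u m - u n) < e) ->
        exists l, hcvg H u l].

Definition hdense (E : lmodType C) (H : ipspace E) (D : set E) : Prop :=
  D `<=` carrier H /\
  forall f, H f -> forall e : R, 0 < e -> exists2 g, D g & hnorm H (f - g) < e.

(* The sum of the series of the t i in the norm of H (0 if it diverges). *)
Definition hsum (E : lmodType C) (H : ipspace E) (t : nat -> E) : E :=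
  xget 0 [set l | hcvg H (fun n => \sum_(i < n) t i) l].

Definition op_graph (E : Type) (D : set E) (T : E -> E) : set (E * E) :=
  [set p | D p.1 /\ p.2 = T p.1].

Definition adjoint (E : lmodType C) (H : ipspace E) (G : set (E * E)) : set (E * E) :=
  [set p | [/\ H p.1, H p.2 & forall q, G q -> ip H p.1 q.2 = ip H p.2 q.1]].

Definition gclosure (E : lmodType C) (H : ipspace E) (G : set (E * E)) : set (E * E) :=
  [set p | [/\ H p.1, H p.2 & forall e : R, 0 < e ->
     exists2 q, G q & hnorm H (p.1 - q.1) < e /\ hnorm H (p.2 - q.2) < e]].

(* T^* = - T, as an equality of graphs. *)
Definition skew_adjoint (E : lmodType C) (H : ipspace E) (G : set (E * E)) : Prop :=
  adjoint H G = [set p | G (p.1, - p.2)].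

Definition densely_defined_operator (E : lmodType C) (H : ipspace E)
    (D : set E) (T : E -> E) : Prop :=
  [/\ linear_subspace D, hdense H D, forall f, D f -> H (T f) &
      forall (a : C) f g, D f -> D g -> T (a *: f + g) = a *: T f + T g].

Definition antisymmetric_on (E : lmodType C) (H : ipspace E)
    (D : set E) (T : E -> E) : Prop :=
  forall f g, D f -> D g -> ip H f (T g) = - ip H (T f) g.

Definition essentially_skew_adjoint (E : lmodType C) (H : ipspace E)
    (D : set E) (T : E -> E) : Prop :=
  [/\ densely_defined_operator H D T, antisymmetric_on H D T &
      skew_adjoint H (gclosure H (op_graph D T))].

(* Adjoint of a densely defined operator T with domain D, as a function
   (equal to 0 outside its domain). *)
Definition adj_dom (E : lmodType C) (H : ipspace E) (D : set E) (T : E -> E) : set E :=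
  [set f | exists g, adjoint H (op_graph D T) (f, g)].

Definition adj (E : lmodType C) (H : ipspace E) (D : set E) (T : E -> E) (f : E) : E :=
  xget 0 [set g | adjoint H (op_graph D T) (f, g)].

Definition jointly_analytic (E : lmodType C) (H : ipspace E) (D : set E)
    (Ts : 'I_2 -> E -> E) : Prop :=
  forall f, D f -> exists2 r : R, 0 < r &
    forall z : C, `|z| < r%:C ->
      cvgn (series (fun n => z ^+ n / n`!%:R *
        (\sum_(eps : {ffun 'I_n -> 'I_2})
           hnorm H (foldr (fun i g => Ts (eps i) g) f (enum 'I_n)))%:C : C^o)).

End HilbertSpaces.

Section RKHS.
Context {R : realType}.
Local Notation C := R[i].

Definition strictly_positive_definite (X : Type) (k : X -> X -> C) : Prop :=
  forall (m : nat) (x : 'I_m -> X) (c : 'I_m -> C), injective x ->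
    (exists i, c i != 0) ->
    0 < \sum_(i < m) \sum_(j < m) (c i)^*%C * c j * k (x i) (x j).

(* k x is the kernel section k(x, .). *)
Definition rkhs (X : Type) (H : ipspace (X -> C)) (k : X -> X -> C) : Prop :=
  [/\ is_hilbert H, forall x, H (k x) &
      forall f x, H f -> f x = ip H (k x) f].

Definition continuous_compact_open (X : topologicalType) (H : ipspace (X -> C))
    (V : (X -> C) -> (X -> C)) : Prop :=
  forall f (U : set (X -> C^o)), H f ->
    nbhs (V f : {compact-open, X -> C^o}) U ->
    exists2 e : R, 0 < e & forall g, H g -> hnorm H (g - f) < e -> U (V g).

End RKHS.

(* The Hilbert tensor product l^2(N) (x) H, realised as the square-summable
   H-valued sequences with (a (x) f)_i = a_i f.  Indices start at 0:
   [unit_seq i] is the (i+1)-st canonical basis vector. *)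
Section Amplification.
Context {R : realType} (E : lmodType R[i]).
Local Notation C := R[i].

Definition ell2 (H : ipspace E) : ipspace (nat -> E) := {|
  carrier := [set u | (forall i, H (u i)) /\
                      cvgn (series (fun i => hnorm H (u i) ^+ 2))];
  ip := fun u v => limn (series (fun i => ip H (u i) (v i) : C^o)) |}.

Definition tensor (a : nat -> C) (f : E) : nat -> E := fun i => a i *: f.

Definition unit_seq (i : nat) : nat -> C := fun j => (i == j)%:R.

Definition fin_supp (a : nat -> C) : Prop :=
  exists N, forall i, (N <= i)%N -> a i = 0.

(* C_c(N) (x)_alg D *)
Definition alg_tensor (D : set E) : set (nat -> E) :=
  [set u | exists m (a : 'I_m -> nat -> C) (f : 'I_m -> E),
     [/\ forall k, fin_supp (a k), forall k, D (f k) &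
         u = \sum_(k < m) tensor (a k) (f k)]].

(* The matrix unit tensored with T: sends a (x) f to a_j e_i (x) T f *)
Definition munit_tensor (i j : nat) (T : E -> E) (u : nat -> E) : nat -> E :=
  tensor (unit_seq i) (T (u j)).

Definition Lop (H : ipspace E) (S A : E -> E) (u : nat -> E) : nat -> E :=
  hsum (ell2 H) (fun i =>
    munit_tensor i i.+1 S u + munit_tensor i i A u - munit_tensor i.+1 i S u).

Definition Lplus (H : ipspace E) (S A : E -> E) (u : nat -> E) : nat -> E :=
  hsum (ell2 H) (fun i =>
    munit_tensor i i.+1 S u - munit_tensor i i A u - munit_tensor i.+1 i S u).

Fixpoint fib (n : nat) : nat :=
  match n with
  | 0 => 0
  | 1 => 1
  | (m.+1 as p).+1 => fib p + fib m
  end.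

Definition fib_embed (n : nat) (f : E) : nat -> E :=
  \sum_(i < n) (fib i.+1)%:R *: tensor (unit_seq i) f.

(* p_1 (x) Id *)
Definition proj1 (u : nat -> E) : E := u 0%N.

End Amplification.

(* Main.v *)
(** Nelson's analytic vector theorem, proved without spectral theory. If T is antisymmetric and q is
    an analytic vector, the partial sums p_N(T) of exp(-tT) are asymptotically isometric on q for
    small t, while p_N(T) q = p_N(-1) q modulo the range of 1 + T and p_N(-1) >= 1 + t. Hence q is
    within |q| / (1 + t) of that range; p_N(T) q is again analytic with the same radius, so iterating
    shows that the range of 1 + T is dense. The same holds for 1 - T, and density of both ranges
    gives essential skew-adjointness.

    For L, let M_n(u) be the sum over all coordinates u_i and all words w of length n in V and V^* of
    the norms of w u_i. Then M_n(L u) <= 3/2 M_(n+1)(u), so joint analyticity makes every vector of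
    the algebraic tensor product analytic. L^+ is L with V and V^* exchanged.
    The Fibonacci recursion F_(i+2) S + F_(i+1) A - F_i S = F_(i+1) (S + A) gives part (b). *)

Require Import Defs.
From mathcomp Require Import all_boot all_order all_algebra.
From mathcomp Require Import complex.
From mathcomp Require Import all_classical all_reals all_analysis.
From mathcomp Require Import ring lra.

Import Order.TTheory GRing.Theory Num.Theory.
Import numFieldNormedType.Exports.

Local Open Scope classical_set_scope.
Local Open Scope complex_scope.
Local Open Scope ring_scope.

Set Implicit Arguments.
Unset Strict Implicit.
Unset Printing Implicit Defensive.

(** The exponential exp(-tT) q is a limit and may leave D, whereas the range to be shown dense is
    that of 1 + T on D itself. Polynomials in T keep every vector in D, and their failure to be
    isometric is an error of order 2^-N. Each iteration gains only a factor 1/(1 + t), so one t must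
    serve for all of them: hence an analytic class with a fixed radius and varying constants. All
    estimates concern finitely many vectors of D, so they are stated for the inner product axioms
    alone ([prehilbert]), a form that [ell2 H] inherits from H coordinatewise. Joint analyticity
    enters because S and A mix V and V^*: powers of L produce all words in the two operators, not
    only powers of each. *)

Definition prehilbert (R : realType) (E : lmodType R[i]) (H : ipspace E) : Prop :=
  [/\ linear_subspace (carrier H),
      forall f g h (a : R[i]), H f -> H g -> H h ->
        ip H f (a *: g + h) = a * ip H f g + ip H f h,
      forall f g, H f -> H g -> ip H g f = (ip H f g)^*%C &
      forall f, H f -> f != 0 -> 0 < ip H f f].

Lemma is_hilbert_prehilbert (R : realType) (E : lmodType R[i]) (H : ipspace E) :
  is_hilbert H -> prehilbert H.
Proof. by case. Qed.

(** * Subspaces and inner product calculus *)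

Section Subspace.
Context {R : realType} {E : lmodType R[i]} {D : set E}.
Hypothesis DD : linear_subspace D.

Lemma subspace0 : D 0. Proof. by case: DD. Qed.

Lemma subspaceZ a f : D f -> D (a *: f).
Proof. by case: DD => D0 DL Df; rewrite -[_ *: _]addr0; apply: DL. Qed.

Lemma subspaceD f g : D f -> D g -> D (f + g).
Proof. by case: DD => _ DL Df Dg; rewrite -[f]scale1r; apply: DL. Qed.

Lemma subspaceN f : D f -> D (- f).
Proof. by move=> Df; rewrite -scaleN1r; apply: subspaceZ. Qed.

Lemma subspaceB f g : D f -> D g -> D (f - g).
Proof. by move=> Df Dg; apply: subspaceD => //; apply: subspaceN. Qed.

Lemma subspace_sum I (r : seq I) P (F : I -> E) :
  (forall i, D (F i)) -> D (\sum_(i <- r | P i) F i).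
Proof.
by move=> DF; apply: (big_ind D) => //; [exact: subspace0 | exact: subspaceD].
Qed.

End Subspace.

(** Estimates are made on the real part, which lives in an ordered field and determines the norm.
    [Im_ip] recovers the imaginary part by rotating one argument by ['i]. *)
Definition rip (R : realType) (E : lmodType R[i]) (H : ipspace E) (f g : E) : R :=
  complex.Re (ip H f g).

Lemma ReD (R : realType) (x y : R[i]) :
  complex.Re (x + y) = complex.Re x + complex.Re y.
Proof. by case: x; case: y. Qed.

Lemma ImD (R : realType) (x y : R[i]) :
  complex.Im (x + y) = complex.Im x + complex.Im y.
Proof. by case: x; case: y. Qed.

Lemma Re_conjc (R : realType) (x : R[i]) : complex.Re x^*%C = complex.Re x.
Proof. by case: x. Qed.

Lemma ReZ (R : realType) (a : R) (x : R[i]) :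
  complex.Re (a%:C * x) = a * complex.Re x.
Proof. by case: x => b c /=; rewrite mul0r subr0. Qed.

Section Prehilbert.
Context {R : realType} {E : lmodType R[i]} {H : ipspace E}.
Local Notation C := R[i].
Hypothesis HH : prehilbert H.

Lemma prehilbert_subspace : linear_subspace (carrier H).
Proof. by case: HH. Qed.
Let H0 := subspace0 prehilbert_subspace.
Let HD := subspaceD prehilbert_subspace.
Let HN := subspaceN prehilbert_subspace.
Let HB := subspaceB prehilbert_subspace.
Let HZ := subspaceZ prehilbert_subspace.

#[local] Hint Resolve H0 HD HN HB HZ : core.

Lemma ip_conj f g : H f -> H g -> ip H g f = (ip H f g)^*%C.
Proof. by case: HH => _ _ + _; apply. Qed.

Lemma ipDr f g h : H f -> H g -> H h -> ip H f (g + h) = ip H f g + ip H f h.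
Proof.
by case: HH => _ L _ _ Hf Hg Hh; rewrite -{1}[g]scale1r L // mul1r.
Qed.

Lemma ip0r f : H f -> ip H f 0 = 0.
Proof.
by move=> Hf; apply: (addrI (ip H f 0)); rewrite -ipDr // !addr0.
Qed.

Lemma ipZr a f g : H f -> H g -> ip H f (a *: g) = a * ip H f g.
Proof.
by case: HH => _ L _ _ Hf Hg; rewrite -[_ *: _]addr0 L // ip0r // addr0.
Qed.

Lemma ipNr f g : H f -> H g -> ip H f (- g) = - ip H f g.
Proof. by move=> Hf Hg; rewrite -scaleN1r ipZr // mulN1r. Qed.

Lemma ipBr f g h : H f -> H g -> H h -> ip H f (g - h) = ip H f g - ip H f h.
Proof. by move=> Hf Hg Hh; rewrite ipDr ?ipNr //; auto. Qed.

Lemma ipDl f g h : H f -> H g -> H h -> ip H (f + g) h = ip H f h + ip H g h.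
Proof.
move=> Hf Hg Hh; rewrite ip_conj ?ipDr //; last by auto.
by rewrite rmorphD /= -!ip_conj.
Qed.

Lemma ipZl a f g : H f -> H g -> ip H (a *: f) g = a^*%C * ip H f g.
Proof.
move=> Hf Hg; rewrite ip_conj ?ipZr //; last by auto.
by rewrite rmorphM /= -ip_conj.
Qed.

Lemma ip0l f : H f -> ip H 0 f = 0.
Proof. by move=> Hf; rewrite ip_conj // ip0r // conjc0. Qed.

Lemma ipNl f g : H f -> H g -> ip H (- f) g = - ip H f g.
Proof.
by move=> Hf Hg; rewrite ip_conj ?ipNr //; auto; rewrite rmorphN /= -ip_conj.
Qed.

Lemma ipBl f g h : H f -> H g -> H h -> ip H (f - g) h = ip H f h - ip H g h.
Proof. by move=> Hf Hg Hh; rewrite ipDl ?ipNl //; auto. Qed.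

Lemma Im_ip f g : H f -> H g -> complex.Im (ip H f g) = - rip H f ('i *: g).
Proof.
move=> Hf Hg; rewrite /rip ipZr //.
by case: (ip H f g) => a b /=; rewrite mul0r mul1r sub0r opprK.
Qed.

Lemma ripC f g : H f -> H g -> rip H f g = rip H g f.
Proof. by move=> Hf Hg; rewrite /rip ip_conj // Re_conjc. Qed.

Lemma ripDr f g h : H f -> H g -> H h -> rip H f (g + h) = rip H f g + rip H f h.
Proof. by move=> Hf Hg Hh; rewrite /rip ipDr // ReD. Qed.

Lemma ripNr f g : H f -> H g -> rip H f (- g) = - rip H f g.
Proof. by move=> Hf Hg; rewrite /rip ipNr //; case: ip. Qed.

Lemma ripBr f g h : H f -> H g -> H h -> rip H f (g - h) = rip H f g - rip H f h.
Proof. by move=> Hf Hg Hh; rewrite ripDr ?ripNr //; auto. Qed.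

Lemma ripZr (a : R) f g : H f -> H g -> rip H f (a%:C *: g) = a * rip H f g.
Proof. by move=> Hf Hg; rewrite /rip ipZr // ReZ. Qed.

Lemma ripDl f g h : H f -> H g -> H h -> rip H (f + g) h = rip H f h + rip H g h.
Proof. by move=> Hf Hg Hh; rewrite /rip ipDl // ReD. Qed.

Lemma ripNl f g : H f -> H g -> rip H (- f) g = - rip H f g.
Proof. by move=> Hf Hg; rewrite /rip ipNl //; case: ip. Qed.

Lemma ripBl f g h : H f -> H g -> H h -> rip H (f - g) h = rip H f h - rip H g h.
Proof. by move=> Hf Hg Hh; rewrite ripDl ?ripNl //; auto. Qed.

Lemma ripZl (a : R) f g : H f -> H g -> rip H (a%:C *: f) g = a * rip H f g.
Proof. by move=> Hf Hg; rewrite ripC ?ripZr // ?[rip H g f]ripC; auto. Qed.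

Lemma rip_suml (I : Type) (r : seq I) P (F : I -> E) g : (forall i, H (F i)) -> H g ->
  rip H (\sum_(i <- r | P i) F i) g = \sum_(i <- r | P i) rip H (F i) g.
Proof.
move=> HF Hg.
suff: H (\sum_(i <- r | P i) F i) /\
  rip H (\sum_(i <- r | P i) F i) g = \sum_(i <- r | P i) rip H (F i) g by case.
apply: (big_rec2 (fun x y => H x /\ rip H x g = y)).
  by split=> //; rewrite /rip ip0l.
by move=> i x y _ [Hx Hy]; split; [auto | rewrite ripDl // Hy].
Qed.

Lemma rip_sumr (I : Type) (r : seq I) P (F : I -> E) g : (forall i, H (F i)) -> H g ->
  rip H g (\sum_(i <- r | P i) F i) = \sum_(i <- r | P i) rip H g (F i).
Proof.
move=> HF Hg; rewrite ripC ?rip_suml //.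
  by apply: eq_bigr => i _; rewrite ripC.
exact: (subspace_sum prehilbert_subspace).
Qed.

Lemma rip_gt0 f : H f -> f != 0 -> 0 < rip H f f.
Proof. by case: HH => _ _ _ P Hf f0; have := P f Hf f0; rewrite ltcE => /andP[]. Qed.

Lemma rip_ge0 f : H f -> 0 <= rip H f f.
Proof.
move=> Hf; have [->|f0] := eqVneq f 0; last exact/ltW/rip_gt0.
by rewrite /rip ip0r.
Qed.

Lemma hnorm_sqr f : H f -> hnorm H f ^+ 2 = rip H f f.
Proof. by move=> Hf; rewrite /hnorm sqr_sqrtr // rip_ge0. Qed.

Lemma hnorm_ge0 f : 0 <= hnorm H f. Proof. exact: sqrtr_ge0. Qed.

Lemma hnorm0 : hnorm H 0 = 0.
Proof. by rewrite /hnorm ip0r // sqrtr0. Qed.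

Lemma hnorm_eq0 f : H f -> hnorm H f = 0 -> f = 0.
Proof.
move=> Hf n0; apply/eqP/negPn/negP => /(rip_gt0 Hf).
by rewrite -hnorm_sqr // n0 expr0n ltxx.
Qed.

Lemma ip_self f : H f -> ip H f f = (hnorm H f ^+ 2)%:C.
Proof.
move=> Hf; rewrite hnorm_sqr // /rip; have := ip_conj Hf Hf.
by case: (ip H f f) => a b /= [] h; congr (_ +i* _); lra.
Qed.

Lemma hnormN f : H f -> hnorm H (- f) = hnorm H f.
Proof. by move=> Hf; rewrite /hnorm ipNl ?ipNr ?opprK //; auto. Qed.

Lemma hnormZ (a : R) f : H f -> hnorm H (a%:C *: f) = `|a| * hnorm H f.
Proof.
move=> Hf; apply/(@pexpIrn _ 2); rewrite ?nnegrE ?mulr_ge0 ?hnorm_ge0 //.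
rewrite exprMn !hnorm_sqr //; last by auto.
by rewrite ripZl ?ripZr ?real_normK ?num_real ?mulrA -?expr2 //; auto.
Qed.

Lemma hnorm_sqrZ (a : C) f : H f ->
  hnorm H (a *: f) ^+ 2 = (complex.Re a ^+ 2 + complex.Im a ^+ 2) * hnorm H f ^+ 2.
Proof.
move=> Hf; rewrite !hnorm_sqr //; last by auto.
rewrite /rip ipZl ?ipZr //; last by auto.
by rewrite ip_self //; case: a => a b /=; ring.
Qed.

Lemma hnormi f : H f -> hnorm H ('i *: f) = hnorm H f.
Proof.
move=> Hf; apply/(@pexpIrn _ 2); rewrite ?nnegrE ?hnorm_ge0 //.
by rewrite hnorm_sqrZ //= expr0n add0r expr1n mul1r.
Qed.

Lemma cauchy_schwarz_le f g : H f -> H g -> rip H f g <= hnorm H f * hnorm H g.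
Proof.
move=> Hf Hg; set a := hnorm H f; set b := hnorm H g.
have a0 : 0 <= a := hnorm_ge0 f; have b0 : 0 <= b := hnorm_ge0 g.
have [a0'|a_neq0] := eqVneq a 0.
  by rewrite a0' mul0r (hnorm_eq0 Hf a0') /rip ip0l.
have [b0'|b_neq0] := eqVneq b 0.
  by rewrite b0' mulr0 (hnorm_eq0 Hg b0') /rip ip0r.
have agt : 0 < a by rewrite lt_neqAle eq_sym a_neq0.
have bgt : 0 < b by rewrite lt_neqAle eq_sym b_neq0.
(* With a = |f| and b = |g|, the squared norm of b f - a g equals 2ab (ab - Re <f, g>), and ab > 0
   can be divided out. *)
have Hbf : H (b%:C *: f) by auto.
have Hag : H (a%:C *: g) by auto.
have := rip_ge0 (HB Hbf Hag).
rewrite ripBl ?ripBr //; auto.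
rewrite !ripZl ?ripZr // -!hnorm_sqr // [rip H g f]ripC // -/a -/b => h.
have : 0 <= (a * b) * (2 * (a * b) - 2 * rip H f g).
  by apply: le_trans h _; rewrite le_eqVlt; apply/orP; left; apply/eqP; ring.
by rewrite pmulr_rge0 ?mulr_gt0 // => ?; lra.
Qed.

Lemma cauchy_schwarz f g : H f -> H g -> `|rip H f g| <= hnorm H f * hnorm H g.
Proof.
move=> Hf Hg; rewrite ler_norml cauchy_schwarz_le // andbT.
have := cauchy_schwarz_le (HN Hf) Hg; rewrite ripNl // hnormN // => ?; lra.
Qed.

Lemma cauchy_schwarz_Im f g : H f -> H g ->
  `|complex.Im (ip H f g)| <= hnorm H f * hnorm H g.
Proof.
move=> Hf Hg; rewrite Im_ip // normrN -(hnormi Hg).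
by apply: cauchy_schwarz; auto.
Qed.

Lemma hnormD f g : H f -> H g -> hnorm H (f + g) <= hnorm H f + hnorm H g.
Proof.
move=> Hf Hg; rewrite -(@ler_pXn2r _ 2) ?nnegrE ?addr_ge0 ?hnorm_ge0 //.
rewrite hnorm_sqr ?ripDl ?ripDr //; auto.
have := cauchy_schwarz_le Hf Hg; rewrite sqrrD -!hnorm_sqr // [rip H g f]ripC //.
by move=> ?; lra.
Qed.

Lemma hnormB f g : H f -> H g -> hnorm H (f - g) <= hnorm H f + hnorm H g.
Proof. by move=> Hf Hg; rewrite -(hnormN Hg); apply: hnormD; auto. Qed.

Lemma hdense_sub (D : set E) f : hdense H D -> D f -> H f.
Proof. by move=> [h _]; exact: h. Qed.

Lemma hdense_approx (D : set E) f e : hdense H D -> H f -> 0 < e ->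
  exists2 g, D g & hnorm H (f - g) < e.
Proof. by move=> [_ h] Hf; exact: h. Qed.

(** A single approximant suffices: if x is nonzero, take g in D closer to x than |x|. Then |x|^2 =
    Re <x, x - g> <= |x| |x - g| < |x|^2. *)
Lemma hdense_ip_eq0 (D : set E) x : hdense H D -> H x ->
  (forall q, D q -> rip H x q = 0) -> x = 0.
Proof.
move=> [DH DD] Hx x0; apply: hnorm_eq0 => //; apply/eqP/negPn/negP => xn0.
have n0 : 0 < hnorm H x by rewrite lt_neqAle eq_sym xn0 hnorm_ge0.
have [g Dg gx] := DD x Hx _ n0; have Hg := DH g Dg.
have := cauchy_schwarz_le Hx (HB Hx Hg).
rewrite ripBr // (x0 g Dg) subr0 -hnorm_sqr // expr2 ler_pM2l // => h.
by have := le_lt_trans h gx; rewrite ltxx.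
Qed.

End Prehilbert.

(** * Factorial bounds and the cancellation identity on antidiagonals *)

Lemma bin_le_exp2 n m : ('C(n, m) <= 2 ^ n)%N.
Proof.
elim: n m => [|n IH] [|m] //; first by rewrite bin0 expn_gt0.
by rewrite binS expnS mul2n -addnn leq_add.
Qed.

Lemma factD_le n j : ((n + j)`! <= 2 ^ (n + j) * (n`! * j`!))%N.
Proof.
by rewrite -(@bin_fact (n + j) n) ?leq_addr // addKn leq_mul // bin_le_exp2.
Qed.

Lemma bernoulli_le (R : realFieldType) (t : R) k : 0 <= t -> 1 + k%:R * t <= (1 + t) ^+ k.
Proof.
move=> t0; elim: k => [|k IH]; first by rewrite mul0r addr0.
rewrite exprS; apply: le_trans (ler_wpM2l _ IH); last by lra.
have : 0 <= k%:R * t * t by rewrite !mulr_ge0.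
by rewrite -natr1 => ?; lra.
Qed.

Lemma sum_triangle (R : nmodType) (G : nat -> nat -> R) N :
  \sum_(0 <= m < N) \sum_(0 <= n < N - m) G m n =
  \sum_(0 <= s < N) \sum_(0 <= m < s.+1) G m (s - m)%N.
Proof.
elim: N => [|N IH]; first by rewrite !big_geq.
rewrite [RHS]big_nat_recr //= -IH big_nat_recr //= subSn // subnn big_nat1.
rewrite [in RHS]big_nat_recr //= subnn addrA -big_split /=; congr (_ + _).
by apply: eq_big_nat => m /andP[_ mN]; rewrite subSn ?(ltnW mN) // big_nat_recr.
Qed.

(** This is the binomial expansion of (1 - 1)^s divided by s!. It makes every antidiagonal of
    positive degree cancel in the squared norm of a Taylor polynomial. *)
Lemma sum_sign_inv_fact (R : numFieldType) s : (0 < s)%N ->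
  \sum_(0 <= m < s.+1) (-1) ^+ m / (m`!%:R * (s - m)`!%:R) = 0 :> R.
Proof.
move=> s0; have := exprDn (1 : R) (-1) s; rewrite subrr expr0n gtn_eqF // => h.
apply/(mulfI (_ : s`!%:R != 0 :> R)); rewrite ?pnatr_eq0 -?lt0n ?fact_gt0 //.
rewrite mulr0 [RHS]h big_mkord mulr_sumr; apply: eq_bigr => i _.
rewrite expr1n mul1r -mulr_natr.
have fn0 j : j`!%:R != 0 :> R by rewrite pnatr_eq0 -lt0n fact_gt0.
by rewrite -(bin_fact (leq_ord i)) !natrM; field; rewrite !fn0.
Qed.

(** * Analytic vectors of an antisymmetric operator lie in the closure of the range of 1 + T *)

Section Nelson.
Context {R : realType} {E : lmodType R[i]} {H : ipspace E} {D : set E} {T : E -> E}.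
Hypothesis HH : prehilbert H.
Hypothesis DD : linear_subspace D.
Hypothesis DH : D `<=` carrier H.
Hypothesis TD : forall f, D f -> D (T f).
Hypothesis Tlin : forall (a : R[i]) f g, D f -> D g -> T (a *: f + g) = a *: T f + T g.
Hypothesis Tanti : antisymmetric_on H D T.

Let D0 := subspace0 DD.
Let addD := subspaceD DD.
Let oppD := subspaceN DD.
Let subD := subspaceB DD.
Let scaleD := subspaceZ DD.
#[local] Hint Resolve D0 addD oppD subD scaleD DH TD : core.
Let HB := subspaceB (prehilbert_subspace HH).
Let HD := subspaceD (prehilbert_subspace HH).
Let HZ := subspaceZ (prehilbert_subspace HH).

Lemma linear_onD f g : D f -> D g -> T (f + g) = T f + T g.
Proof. by move=> Df Dg; rewrite -{1}[f]scale1r Tlin // scale1r. Qed.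

Lemma linear_on0 : T 0 = 0.
Proof. by apply: (addrI (T 0)); rewrite -linear_onD // !addr0. Qed.

Lemma linear_onZ a f : D f -> T (a *: f) = a *: T f.
Proof. by move=> Df; rewrite -[_ *: _]addr0 Tlin // linear_on0 addr0. Qed.

Lemma linear_onB f g : D f -> D g -> T (f - g) = T f - T g.
Proof. by move=> Df Dg; rewrite addrC -scaleN1r Tlin // scaleN1r addrC. Qed.

Lemma iter_on n f : D f -> D (iter n T f).
Proof. by move=> Df; elim: n => //= n; auto. Qed.
#[local] Hint Resolve iter_on : core.

Lemma iter_onD n f g : D f -> D g -> iter n T (f + g) = iter n T f + iter n T g.
Proof. by move=> Df Dg; elim: n => //= n ->; rewrite linear_onD; auto. Qed.

Lemma iter_onZ n a f : D f -> iter n T (a *: f) = a *: iter n T f.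
Proof. by move=> Df; elim: n => //= n ->; rewrite linear_onZ; auto. Qed.

(* The inverse r of the radius of convergence is kept fixed; the shift j makes
   the class stable under T. *)
Definition analytic_on (r : R) (q : E) : Prop :=
  D q /\ exists (c : R) (j : nat), 0 <= c /\
    forall n, hnorm H (iter n T q) <= c * (n + j)`!%:R * r ^+ n.

Section Radius.
Variable r : R.
Hypothesis r_gt0 : 0 < r.
Let r_ge0 : 0 <= r := ltW r_gt0.

Lemma analytic_onT q : analytic_on r q -> analytic_on r (T q).
Proof.
move=> [Dq [c [j [c0 cP]]]]; split; first by auto.
exists (c * r), j.+1; split=> [|n]; first by rewrite mulr_ge0.
by rewrite -iterSr; apply: le_trans (cP _) _; rewrite addSnnS exprS; lra.
Qed.

Lemma analytic_on_iter n q : analytic_on r q -> analytic_on r (iter n T q).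
Proof. by move=> aq; elim: n => //= n; apply: analytic_onT. Qed.

Lemma analytic_onD f g : analytic_on r f -> analytic_on r g -> analytic_on r (f + g).
Proof.
move=> [Df [c [i [c0 cP]]]] [Dg [c' [j [c0' cP']]]]; split; first by auto.
exists (c + c'), (i + j)%N; split=> [|n]; first by rewrite addr_ge0.
rewrite iter_onD //; apply: le_trans (hnormD HH _ _) _; rewrite ?mulrDl; auto.
apply: lerD; [apply: le_trans (cP n) _ | apply: le_trans (cP' n) _].
  rewrite ler_wpM2r ?exprn_ge0 // ler_wpM2l // ler_nat.
  by rewrite leq_fact // leq_add2l leq_addr.
rewrite ler_wpM2r ?exprn_ge0 // ler_wpM2l // ler_nat.
by rewrite leq_fact // leq_add2l leq_addl.
Qed.

Lemma analytic_onZ (a : R) f : analytic_on r f -> analytic_on r (a%:C *: f).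
Proof.
move=> [Df [c [i [c0 cP]]]]; split; first by auto.
exists (`|a| * c), i; split=> [|n]; first by rewrite mulr_ge0.
by rewrite iter_onZ // hnormZ -?mulrA ?ler_wpM2l // ?mulrA //; auto.
Qed.

Lemma analytic_on0 : analytic_on r 0.
Proof.
split=> //; exists 0, 0%N; split=> // n; rewrite !mul0r.
by rewrite -(scale0r (0 : E)) iter_onZ // scale0r (hnorm0 HH).
Qed.

Lemma analytic_on_sum (I : Type) (s : seq I) P (F : I -> E) :
  (forall i, analytic_on r (F i)) -> analytic_on r (\sum_(i <- s | P i) F i).
Proof.
move=> aF; apply: (big_ind (analytic_on r)) => //; first exact: analytic_on0.
exact: analytic_onD.
Qed.

(** The shift j is removed at the price of doubling r, since (n + j)! <= 2^(n + j) n! j!. This is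
    why [2 * r] appears in the smallness condition on t. *)
Lemma analytic_on_fact q : analytic_on r q -> exists c : R, 0 <= c /\
  forall n, hnorm H (iter n T q) <= c * n`!%:R * (2 * r) ^+ n.
Proof.
move=> [Dq [c [j [c0 cP]]]]; exists (c * 2 ^+ j * j`!%:R); split=> [|n].
  by rewrite !mulr_ge0 // exprn_ge0.
apply: le_trans (cP n) _.
have -> : c * 2 ^+ j * j`!%:R * n`!%:R * (2 * r) ^+ n =
    c * (2 ^ (n + j) * (n`! * j`!))%:R * r ^+ n.
  by rewrite !natrM natrX exprMn exprD; ring.
by rewrite ler_wpM2r ?exprn_ge0 // ler_wpM2l // ler_nat factD_le.
Qed.

Lemma rip_iter m n q : D q ->
  rip H (iter m T q) (iter n T q) = (-1) ^+ m * rip H q (iter (m + n) T q).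
Proof.
move=> Dq; elim: m n => [|m IH] n; first by rewrite mul1r.
rewrite addSnnS exprS mulN1r mulNr -IH /rip /= Tanti; auto.
by case: ip => a b /=; rewrite opprK.
Qed.

Section Taylor.
Variable t : R.
Hypothesis t_gt0 : 0 < t.
(** The constant is 8 = 2 * 2 * 2: the error consists of at most N^2 terms, each at most c^2 / 8^N,
    and N <= 2^N used twice leaves c^2 / 2^N. *)
Hypothesis tr : t * (2 * r) <= 8^-1.

Definition taylor_term (n : nat) (q : E) : E := ((- t) ^+ n / n`!%:R)%:C *: iter n T q.
Definition taylor (N : nat) (q : E) : E := \sum_(0 <= n < N) taylor_term n q.

Lemma taylor_term_on n q : D q -> D (taylor_term n q).
Proof. by rewrite /taylor_term; auto. Qed.
#[local] Hint Resolve taylor_term_on : core.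

Lemma taylor_on N q : D q -> D (taylor N q).
Proof. by move=> Dq; apply: (subspace_sum DD) => n; auto. Qed.

Lemma analytic_taylor N q : analytic_on r q -> analytic_on r (taylor N q).
Proof.
by move=> aq; apply: analytic_on_sum => n; apply/analytic_onZ/analytic_on_iter.
Qed.

(* exp (-tT) is isometric, so only the terms beyond the N-th antidiagonal of the
   double sum for the squared norm contribute an error. *)
Lemma hnorm_taylor_le q : analytic_on r q -> exists c : R, 0 <= c /\
  forall N, (0 < N)%N ->
    hnorm H (taylor N q) ^+ 2 <= hnorm H q ^+ 2 + c / 2 ^+ N.
Proof.
move=> aq; have [Dq _] := aq; have [c [c0 cP]] := analytic_on_fact aq.
exists (c ^+ 2); split=> [|N N0]; first by rewrite exprn_ge0.
pose G m n := rip H (taylor_term m q) (taylor_term n q).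
have fgt0 j : 0 < j`!%:R :> R by rewrite ltr0n fact_gt0.
have fn0 j : j`!%:R != 0 :> R by rewrite gt_eqF.
have GE m n : G m n = (-1) ^+ m / (m`!%:R * n`!%:R) *
    ((- t) ^+ (m + n) * rip H q (iter (m + n) T q)).
  rewrite /G /taylor_term ripZl ?ripZr //; auto 6.
  by rewrite rip_iter // exprD; field; rewrite !fn0.
have Gle m n : `|G m n| <= c ^+ 2 * (t * (2 * r)) ^+ (m + n).
  apply: le_trans (cauchy_schwarz HH _ _) _; auto.
  have tle k : hnorm H (taylor_term k q) <= c * (t * (2 * r)) ^+ k.
    rewrite /taylor_term hnormZ //; last by auto.
    rewrite normrM normrX normrN (gtr0_norm t_gt0) normfV (gtr0_norm (fgt0 k)).
    have tk0 : 0 <= t ^+ k / k`!%:R by rewrite divr_ge0 // exprn_ge0 // ltW.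
    have h := ler_wpM2l tk0 (cP k).
    apply: le_trans h _; rewrite [(t * _) ^+ _]exprMn le_eqVlt; apply/orP; left; apply/eqP.
    by field.
  apply: le_trans (ler_pM _ _ (tle m) (tle n)) _; rewrite ?hnorm_ge0 //.
  by rewrite exprD; lra.
have -> : hnorm H (taylor N q) ^+ 2 = \sum_(0 <= m < N) \sum_(0 <= n < N) G m n.
  rewrite hnorm_sqr //; last by apply/DH/taylor_on.
  rewrite /taylor rip_suml //; auto; last by apply/DH/taylor_on.
  by apply: eq_bigr => m _; rewrite rip_sumr //; auto.
(* Row m is cut at n = N - m, separating total degree m + n < N, where cancellation is complete,
   from m + n >= N, where antidiagonals are truncated. *)
have split_sum m : (m < N)%N -> \sum_(0 <= n < N) G m n =
    \sum_(0 <= n < N - m) G m n + \sum_(N - m <= n < N) G m n.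
  by move=> _; rewrite (@big_cat_nat _ _ _ (N - m)) // leq_subr.
rewrite (eq_big_nat _ _ (fun m Hm => split_sum m (proj2 (andP Hm)))) big_split /=.
apply: lerD.
  (* In the lower triangle the antidiagonal s = 0 gives the squared norm of q, and all others
     vanish. *)
  rewrite sum_triangle big_ltn // big_nat1 GE /= big_nat big1 => [|s /andP[s0 sN]].
    by rewrite fact0 addn0 !mulr1 invr1 !mul1r addr0 hnorm_sqr //; auto.
  rewrite big_nat.
  rewrite (eq_bigr (fun m => (-1) ^+ m / (m`!%:R * (s - m)`!%:R) *
    ((- t) ^+ s * rip H q (iter s T q)))); last first.
    by move=> m /andP[_ ms]; rewrite GE subnKC.
  by rewrite -big_nat -mulr_suml sum_sign_inv_fact // mul0r.
have x0 : 0 <= t * (2 * r) by rewrite !mulr_ge0 ?ltW.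
(* The upper triangle is bounded by the same constant summed over the full N by N square. *)
have bound : \sum_(0 <= m < N) \sum_(0 <= n < N) c ^+ 2 / 8 ^+ N <= c ^+ 2 / 2 ^+ N.
  rewrite !sumr_const_nat subn0 -mulrnA -[_ *+ (N * N)]mulr_natl natrM.
  have : N%:R <= (2 : R) ^+ N by rewrite -natrX ler_nat ltnW // ltn_expl.
  have e8 : (8 : R) = 2 * 2 * 2 by ring.
  rewrite e8 !exprMn; set w := (2 : R) ^+ N => Nw.
  have w0 : 0 < w by rewrite exprn_gt0.
  rewrite -[leRHS](_ : w * w * (c ^+ 2 / (w * w * w)) = _); last first.
    by field; rewrite gt_eqF.
  rewrite ler_wpM2r ?divr_ge0 ?exprn_ge0 ?mulr_ge0 ?(ltW w0) //.
  by apply: ler_pM.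
apply: le_trans bound; apply: ler_sum_nat => m /andP[_ mN].
rewrite [leRHS](@big_cat_nat _ _ _ (N - m)) ?leq_subr //=.
apply: ler_wpDl.
  by apply: sumr_ge0 => i _; rewrite divr_ge0 ?exprn_ge0.
apply: ler_sum_nat => n /andP[mn nN].
apply: le_trans (ler_norm _) _; apply: le_trans (Gle m n) _.
rewrite ler_wpM2l ?exprn_ge0 // -exprVn.
apply: (@le_trans _ _ (8^-1 ^+ (m + n))); first by rewrite lerXn2r ?nnegrE ?invr_ge0.
(* In the upper triangle m + n >= N, so the power of 1/8 is at most that of exponent N. *)
by rewrite ler_wiXn2l ?invr_ge0 ?invf_le1 ?ler1n // -leq_subLR.
Qed.

(** Modulo the range of 1 + T, T acts as -1, so the signs of (-t)^n and (-1)^n cancel and c is a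
    partial sum of exp t. With 1 < N it contains the terms 1 + t. *)
Lemma taylor_modulo_range N q : (1 < N)%N -> D q ->
  exists (c : R) (g : E), [/\ 1 + t <= c, D g & taylor N q = c%:C *: q + (g + T g)].
Proof.
move=> N1 Dq.
have step n : exists g, D g /\ iter n T q = ((-1) ^+ n)%:C *: q + (g + T g).
  elim: n => [|n [g [Dg e]]].
    by exists 0; split=> //; rewrite linear_on0 !addr0 scale1r.
  (* From T^(n+1) q = -T^n q + (1 + T) T^n q, with the induction hypothesis substituted for the
     first T^n q. *)
  exists (iter n T q - g); split; first by auto.
  rewrite linear_onB //=; last by auto.
  rewrite -[in RHS]/(iter n T q) exprS mulN1r.
  have -> : (- (-1) ^+ n)%:C *: q = - (((-1) ^+ n)%:C *: q) by rewrite rmorphN scaleNr.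
  have e' : iter n T q - (g + T g) = ((-1) ^+ n)%:C *: q by rewrite {1}e addrK.
  by rewrite addrACA -opprD addrAC e' addrA addNr add0r.
case: N N1 => [//|[//|N]] _.
elim: N => [|N [c [g [c1 Dg e]]]].
  exists (1 + t), (- (t%:C *: q)); split; [by [] | by auto |].
  rewrite /taylor big_nat_recr //= big_nat1 /taylor_term /= fact0 divr1 expr1 scale1r.
  rewrite -scaleNr linear_onZ // divr1 !rmorphN !scaleNr.
  by rewrite rmorphD scalerDl scale1r addrA addrK.
have [h [Dh e']] := step N.+2.
exists (c + t ^+ N.+2 / N.+2`!%:R), (g + ((- t) ^+ N.+2 / N.+2`!%:R)%:C *: h); split.
- by apply: le_trans c1 _; rewrite lerDl divr_ge0 // exprn_ge0 // ltW.
- by auto.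
rewrite /taylor big_nat_recr //= -/(taylor _ _) e /taylor_term e'.
set x := (- t) ^+ N.+2 / _; set y := t ^+ N.+2 / _.
have xy : x * (-1) ^+ N.+2 = y by rewrite /x mulrAC -exprMn mulrN1 opprK.
rewrite scalerDr scalerA -[_ * _]rmorphM xy scalerDr.
rewrite linear_onD ?linear_onZ //; last by auto.
by rewrite rmorphD scalerDl addrACA; congr (_ + _); rewrite addrACA.
Qed.

(** If p q = c q + (1 + T) h for the Taylor polynomial p, then approximating p q by (1 + T) g
    approximates q by (1 + T) (g - h) / c with the error divided by c >= 1 + t. Since p q is hardly
    longer than q, induction on k accumulates these factors; half of e pays for the growth of the
    norm and half for the induction hypothesis. *)
Lemma range_approx k q e : analytic_on r q -> 0 < e ->
  exists g, D g /\ hnorm H (q - (g + T g)) <= hnorm H q / (1 + t) ^+ k + e.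
Proof.
have t0 : 0 < t := t_gt0.
have t1 : 0 < 1 + t by rewrite addr_gt0.
elim: k q e => [|k IH] q e aq e0.
  by exists 0; split=> //; rewrite linear_on0 !addr0 subr0 expr0 invr1 mulr1 lerDl ltW.
have [Dq _] := aq.
have e2 : 0 < e / 2 by lra.
have [c [c0 cP]] := hnorm_taylor_le aq.
(* A defect of at most (e/2)^2 suffices because |q|^2 + (e/2)^2 <= (|q| + e/2)^2. The shift by 2
   ensures 1 < N for [taylor_modulo_range]. *)
have [N [N1 Nle]] : exists N, (1 < N)%N /\ c / 2 ^+ N <= (e / 2) ^+ 2.
  have ee : 0 < (e / 2) ^+ 2 by rewrite exprn_gt0.
  exists (Num.bound (c / (e / 2) ^+ 2)).+2; split=> //.
  rewrite ler_pdivrMr ?exprn_gt0 // mulrC -ler_pdivrMr //.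
  apply: le_trans (ltW (archi_boundP _)) _; first by rewrite divr_ge0 // ltW.
  rewrite -natrX ler_nat; apply: leq_trans (ltnW (ltn_expl _ (isT : 1 < 2)%N)) _.
  by rewrite leq_exp2l // ltnW // ltnS leqnSn.
have aq' := analytic_taylor N aq.
have [Dq' _] := aq'.
have q'le : hnorm H (taylor N q) <= hnorm H q + e / 2.
  rewrite -(@ler_pXn2r _ 2) ?nnegrE ?addr_ge0 ?hnorm_ge0 //; last by lra.
  apply: le_trans (cP N (ltnW N1)) _.
  have h0 : 0 <= hnorm H q := hnorm_ge0 q.
  have : 0 <= hnorm H q * (e / 2) by rewrite mulr_ge0 // ltW.
  by rewrite sqrrD => ?; lra.
have [g [Dg gle]] := IH _ _ aq' e2.
have [s [h [s1 Dh eh]]] := taylor_modulo_range N1 Dq.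
have s0 : 0 < s by lra.
have sn0 : s != 0 by rewrite gt_eqF.
exists ((s^-1)%:C *: (g - h)); split; first by auto.
have -> : q - ((s^-1)%:C *: (g - h) + T ((s^-1)%:C *: (g - h))) =
    (s^-1)%:C *: (taylor N q - (g + T g)).
  rewrite linear_onZ; last by auto.
  rewrite linear_onB // eh -scalerDr.
  have {1}-> : q = (s^-1)%:C *: (s%:C *: q).
    by rewrite scalerA -rmorphM mulVf // scale1r.
  rewrite -scalerBr; congr (_ *: _); rewrite -!addrA; congr (_ + _).
  by rewrite !opprD !opprK !addrA [- g + h]addrC addrAC -!addrA; congr (_ + _);
    rewrite [in RHS]addrCA.
rewrite hnormZ //; last by auto 7.
have si0 : 0 < s^-1 by rewrite invr_gt0.
have p0 : 0 < (1 + t) ^+ k by rewrite exprn_gt0.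
rewrite (gtr0_norm si0).
have h0 : 0 <= hnorm H q := hnorm_ge0 q.
have le1 : s^-1 <= (1 + t)^-1 by rewrite lef_pV2.
have le2 : (1 + t)^-1 <= 1 by rewrite invf_le1 //; lra.
have pk1 : ((1 + t) ^+ k)^-1 <= 1.
  by rewrite invf_le1 // exprn_ege1 //; lra.
have pk0 : 0 < ((1 + t) ^+ k)^-1 by rewrite invr_gt0.
apply: le_trans (ler_wpM2l (ltW si0) gle) _.
have le3 : hnorm H (taylor N q) / (1 + t) ^+ k <= (hnorm H q + e / 2) / (1 + t) ^+ k.
  by rewrite ler_wpM2r // ltW.
set w := hnorm H (taylor N q) / _ in le3 *.
have w0 : 0 <= w by rewrite divr_ge0 ?hnorm_ge0 // ltW.
rewrite exprS invfM.
set a := (1 + t)^-1 in le1 le2 *; set b := ((1 + t) ^+ k)^-1 in pk1 pk0 le3 *.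
have a0 : 0 < a by rewrite invr_gt0.
apply: (@le_trans _ _ (a * (w + e / 2))); first by rewrite ler_wpM2r //; lra.
apply: (@le_trans _ _ (a * ((hnorm H q + e / 2) * b + e / 2))).
  by rewrite ler_wpM2l //; lra.
have -> : a * ((hnorm H q + e / 2) * b + e / 2) =
  hnorm H q * (a * b) + (a * b * (e / 2) + a * (e / 2)) by ring.
rewrite lerD2l; have : a * b <= 1 by rewrite mulr_ile1 // ltW.
by move=> ab1; have := ler_wpM2r (ltW e2) ab1; have := ler_wpM2r (ltW e2) le2; lra.
Qed.

End Taylor.

Lemma analytic_range_dense q e : analytic_on r q -> 0 < e ->
  exists g, D g /\ hnorm H (q - (g + T g)) < e.
Proof.
move=> aq e0; pose t := 8^-1 / (2 * r).
have t0 : 0 < t by rewrite divr_gt0 // mulr_gt0.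
have tr : t * (2 * r) <= 8^-1 by rewrite /t divfK // gt_eqF // mulr_gt0.
(* By Bernoulli (1 + t)^k >= 1 + k t, so this k brings the main term to at most e/2; with the error
   e/3 the total stays strictly below e. *)
pose k := Num.bound (hnorm H q / (e / 2) / t).
have e3 : 0 < e / 3 by lra.
have [g [Dg gle]] := range_approx t0 tr k aq e3.
exists g; split=> //; apply: le_lt_trans gle _.
have h0 : 0 <= hnorm H q := hnorm_ge0 q.
suff : hnorm H q / (1 + t) ^+ k <= e / 2 by lra.
have p0 : 0 < (1 + t) ^+ k by rewrite exprn_gt0 //; lra.
rewrite ler_pdivrMr // mulrC -ler_pdivrMr; last by lra.
apply: le_trans (bernoulli_le k (ltW t0)).
have : hnorm H q / (e / 2) / t <= k%:R.
  have e2 : 0 <= e / 2 by lra.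
  by apply/ltW/archi_boundP/divr_ge0; [exact: divr_ge0 | exact: ltW].
by rewrite ler_pdivrMr // => ?; lra.
Qed.

End Radius.

End Nelson.

(** * From dense ranges of 1 + T and 1 - T to essential skew-adjointness *)

Section EssentiallySkewAdjoint.
Context {R : realType} {E : lmodType R[i]} {H : ipspace E} {D : set E} {T : E -> E}.
Hypothesis HH : prehilbert H.
Hypothesis DD : linear_subspace D.
Hypothesis Ddense : hdense H D.
Hypothesis TD : forall f, D f -> D (T f).
Hypothesis Tlin : forall (a : R[i]) f g, D f -> D g -> T (a *: f + g) = a *: T f + T g.
Hypothesis Tanti : antisymmetric_on H D T.
Hypothesis Tan : forall q, D q -> exists2 r : R, 0 < r & @analytic_on R E H D T r q.

Let DH : forall f, D f -> H f := fun f => @hdense_sub _ _ _ D f Ddense.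
Let HH' := prehilbert_subspace HH.
Let addD := subspaceD DD.
Let oppD := subspaceN DD.
Let subD := subspaceB DD.
Let scaleD := subspaceZ DD.
Let HB := subspaceB HH'.
Let HN := subspaceN HH'.
Let HD := subspaceD HH'.
Let HZ := subspaceZ HH'.
#[local] Hint Resolve addD oppD subD scaleD DH TD HB HN HD HZ : core.

(** 1 - T is 1 + (-T), and -T is again antisymmetric with the same analytic bounds, so the range
    theorem covers both signs. *)
Let mT (f : E) : E := - T f.

Lemma iter_opp n q : D q -> iter n mT q = ((-1) ^+ n)%:C *: iter n T q.
Proof.
move=> Dq; elim: n => [|n IH] /=; first by rewrite scale1r.
rewrite IH /mT (linear_onZ DD Tlin); last exact: (iter_on TD).
by rewrite exprS mulN1r rmorphN scaleNr.
Qed.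

Lemma analytic_on_opp r q : @analytic_on R E H D T r q -> @analytic_on R E H D mT r q.
Proof.
move=> [Dq [c [j [c0 cP]]]]; split=> //; exists c, j; split=> // n.
rewrite iter_opp // hnormZ //; last by apply/DH/(iter_on TD).
by rewrite normrX normrN1 expr1n mul1r.
Qed.

Lemma range_dense f e : H f -> 0 < e ->
  exists g, D g /\ hnorm H (f - (g + T g)) < e.
Proof.
move=> Hf e0; have e2 : 0 < e / 2 by rewrite divr_gt0.
have [q Dq qf] := hdense_approx Ddense Hf e2; have [r r0 aq] := Tan Dq.
have [g [Dg gq]] := analytic_range_dense HH DD DH TD Tlin Tanti r0 aq e2.
exists g; split=> //; have -> : f - (g + T g) = (f - q) + (q - (g + T g)).
  by rewrite addrA subrK.
apply: le_lt_trans (hnormD HH _ _) _; auto 6.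
by lra.
Qed.

Lemma range_dense_opp f e : H f -> 0 < e ->
  exists g, D g /\ hnorm H (f - (g - T g)) < e.
Proof.
move=> Hf e0; have e2 : 0 < e / 2 by rewrite divr_gt0.
have [q Dq qf] := hdense_approx Ddense Hf e2; have [r r0 aq] := Tan Dq.
have mTD g : D g -> D (mT g) by rewrite /mT; auto.
have mTlin a g h : D g -> D h -> mT (a *: g + h) = a *: mT g + mT h.
  by move=> Dg Dh; rewrite /mT Tlin // opprD scalerN.
have mTanti : antisymmetric_on H D mT.
  by move=> g h Dg Dh; rewrite /mT ipNr ?ipNl ?Tanti //; auto.
have [g [Dg gq]] :=
  analytic_range_dense HH DD DH mTD mTlin mTanti r0 (analytic_on_opp aq) e2.
exists g; split=> //; have -> : f - (g - T g) = (f - q) + (q - (g + mT g)).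
  by rewrite addrA subrK.
apply: le_lt_trans (hnormD HH _ _) _; rewrite /mT; auto 6.
by rewrite /mT in gq; lra.
Qed.

(** Antisymmetry makes Re <g, T g> vanish, so |g - T g|^2 = |g|^2 + |T g|^2. *)
Lemma hnorm_le_oppB g : D g -> hnorm H g <= hnorm H (g - T g).
Proof.
move=> Dg; rewrite -(@ler_pXn2r _ 2) ?nnegrE ?hnorm_ge0 // !hnorm_sqr //; auto.
rewrite ripBl ?ripBr //; auto.
have := Tanti Dg Dg; rewrite [ip H (T g) g](ip_conj HH) //; auto => h.
have t0 : rip H g (T g) = 0.
  by rewrite /rip; move: h; case: ip => a b /= [] h _; lra.
rewrite [rip H (T g) g]ripC //; auto.
by rewrite t0; have := rip_ge0 HH (DH (TD Dg)); lra.
Qed.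

(* If (e, f) is in the graph of the adjoint, testing against g with (1-T)g close
   to e bounds the norm of e by that of e - f. *)
Lemma adjoint_hnorm_le e f : H e -> H f ->
  (forall g, D g -> ip H e (T g) = ip H f g) -> hnorm H e <= hnorm H (e - f).
Proof.
move=> He Hf ef; set d := e - f; have Hd : H d by apply: HB.
have key (x : R) : 0 < x -> hnorm H e ^+ 2 <= hnorm H d * hnorm H e + x * (hnorm H d + hnorm H e).
  move=> x0; have [g [Dg gx]] := range_dense_opp He x0.
  have Hg := DH Dg; have HTg := DH (TD Dg); have Hm : H (g - T g) by auto.
  have He' : H (e - (g - T g)) by auto.
  have e1 : rip H e (g - T g) = rip H d g.
    by rewrite ripBr // ripBl // /rip ef.
  have e2 : hnorm H e ^+ 2 = rip H d g + rip H e (e - (g - T g)).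
    by rewrite -e1 -ripDr // addrC subrK hnorm_sqr.
  have gle : hnorm H g <= hnorm H e + x.
    apply: le_trans (hnorm_le_oppB Dg) _.
    have -> : g - T g = e - (e - (g - T g)) by rewrite subKr.
    by apply: le_trans (hnormB HH _ _) _ => //; rewrite lerD2l ltW.
  rewrite e2; apply: le_trans (lerD (cauchy_schwarz_le HH Hd Hg)
    (cauchy_schwarz_le HH He He')) _.
  have := ler_wpM2l (hnorm_ge0 (H := H) d) gle; have := ler_wpM2l (hnorm_ge0 (H := H) e) (ltW gx).
  by move=> ? ?; lra.
have d0 : 0 <= hnorm H d := hnorm_ge0 d; have e0 : 0 <= hnorm H e := hnorm_ge0 e.
rewrite leNgt; apply/negP => lt_de.
have s0 : 0 < hnorm H d + hnorm H e + 1 by lra.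
have p0 : 0 < hnorm H e * (hnorm H e - hnorm H d) by rewrite mulr_gt0; lra.
(* For this x, [key] would give |e| (|e| - |d|) <= x (|d| + |e|) < x (|d| + |e| + 1) = |e| (|e| -
   |d|). *)
have x0 : 0 < hnorm H e * (hnorm H e - hnorm H d) / (hnorm H d + hnorm H e + 1).
  by rewrite divr_gt0.
have := key _ x0; set x := _ / _ in x0 * => kx.
have : x * (hnorm H d + hnorm H e + 1) = hnorm H e * (hnorm H e - hnorm H d).
  by rewrite /x divfK // gt_eqF.
by rewrite expr2 in kx; lra.
Qed.

(** Choose q in D with (1 + T) q close to x - y. By antisymmetry (x - q, y + T q) still lies in the
    graph of the adjoint, so [adjoint_hnorm_le] bounds |x - q| by |x - y - (1 + T) q|. Hence (q, T
    q) is close to (x, -y). Density of the range of 1 + T is used here, that of 1 - T inside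
    [adjoint_hnorm_le]. *)
Lemma adjoint_sub_gclosure x y : adjoint H (gclosure H (op_graph D T)) (x, y) ->
  gclosure H (op_graph D T) (x, - y).
Proof.
move=> [/= Hx Hy xy]; split=> /=; [by [] | by auto | move=> e e0].
have xyD g : D g -> ip H x (T g) = ip H y g.
  move=> Dg; apply: (xy (g, T g)); split=> [||e1 e10]; [exact: DH | exact/DH/TD |].
  by exists (g, T g); rewrite ?/op_graph /= ?subrr ?(hnorm0 HH).
have e2 : 0 < e / 2 by rewrite divr_gt0.
have [q [Dq qe]] := range_dense (HB Hx Hy) e2.
have Hq := DH Dq; have HTq := DH (TD Dq).
have Ha : H (x - q) by auto.
have Hb : H (y + T q) by auto.
have ab g : D g -> ip H (x - q) (T g) = ip H (y + T q) g.
  move=> Dg; have Hg := DH Dg; have HTg := DH (TD Dg).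
  by rewrite ipBl // ipDl // xyD // (Tanti Dq Dg) opprK.
have dE : x - q - (y + T q) = x - y - (q + T q) by rewrite opprD addrACA -opprD.
have le1 := adjoint_hnorm_le Ha Hb ab; rewrite dE in le1.
exists (q, T q); first by [].
split=> /=; first by lra.
have -> : - y - T q = (x - y - (q + T q)) - (x - q).
  by rewrite -dE [x - q - _]addrC addrK opprD.
apply: le_lt_trans (hnormB HH _ _) _; auto.
by lra.
Qed.

(** The restriction e < 1 lets the caller bound the norm of an approximant by the norm of its target
    plus 1, so that the error is linear in e. *)
Lemma complex_eq0_small (z : R[i]) (c : R) : (forall e : R, 0 < e -> e < 1 ->
  `|complex.Re z| <= c * e /\ `|complex.Im z| <= c * e) -> z = 0.
Proof.
have small (x : R) : (forall e : R, 0 < e -> e < 1 -> `|x| <= c * e) -> x = 0.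
  move=> xe; apply/eqP; rewrite -normr_eq0; apply/eqP/le_anti.
  rewrite normr_ge0 andbT leNgt; apply/negP => x0.
  have c1 : 0 < `|c| + `|x| + 1 by have := normr_ge0 c; lra.
  have e0 : 0 < `|x| / (2 * (`|c| + `|x| + 1)) by rewrite divr_gt0 // mulr_gt0.
  have e1 : `|x| / (2 * (`|c| + `|x| + 1)) < 1.
    by rewrite ltr_pdivrMr ?mulr_gt0 // mul1r; have := normr_ge0 c; lra.
  have := xe _ e0 e1; set e := _ / _ in e0 *.
  have ee : e * (2 * (`|c| + `|x| + 1)) = `|x| by rewrite /e divfK // gt_eqF // mulr_gt0.
  have := ler_wpM2r (ltW e0) (ler_norm c).
  have : 0 < e * `|x| by rewrite mulr_gt0.
  by move=> ? ? ?; lra.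
by case: z => a b /= h; congr (_ +i* _); apply: small => e e0 e1; have [] := h e e0 e1.
Qed.

Lemma gclosure_sub_adjoint x y : gclosure H (op_graph D T) (x, - y) ->
  adjoint H (gclosure H (op_graph D T)) (x, y).
Proof.
move=> [/= Hx HNy xy]; have Hy : H y by rewrite -[y]opprK; auto.
split=> //= -[p q] [/= Hp Hq pq]; apply/eqP; rewrite -subr_eq0; apply/eqP.
apply: (@complex_eq0_small _ (hnorm H x + hnorm H y + hnorm H p + hnorm H q + 2)) => e e0 e1.
have [[a a'] [/= Da ea] /= [xa ya]] := xy e e0.
have [[b b'] [/= Db eb] /= [pb qb]] := pq e e0.
subst a' b'.
have Ha := DH Da; have HTa := DH (TD Da); have Hb := DH Db; have HTb := DH (TD Db).
have Hxa : H (x - a) by auto.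
have Hya : H (- y - T a) by auto.
have Hqb : H (q - T b) by auto.
have Hpb : H (p - b) by auto.
(* The exact terms <a, T b> and <T a, b> cancel by antisymmetry. The four remaining errors are at
   most e |q|, e (|x| + 1), e |p| and e (|y| + 1), whose sum is the constant chosen above. *)
have -> : ip H x q - ip H y p =
    ip H (x - a) q + ip H a (q - T b) + (ip H (- y - T a) p + ip H (T a) (p - b)).
  rewrite !ipBl // !ipBr // ipNl // (Tanti Da Db).
  by ring.
have n0 f : 0 <= hnorm H f := hnorm_ge0 f.
have ale : hnorm H a <= hnorm H x + 1.
  have -> : a = x - (x - a) by rewrite subKr.
  by apply: le_trans (hnormB HH _ _) _ => //; lra.
have Tale : hnorm H (T a) <= hnorm H y + 1.
  have -> : T a = - y - (- y - T a) by rewrite subKr.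
  by apply: le_trans (hnormB HH _ _) _ => //; rewrite hnormN //; lra.
have b1 := ler_pM (n0 _) (n0 _) (ltW xa) (lexx (hnorm H q)).
have b2 := ler_pM (n0 _) (n0 _) ale (ltW qb).
have b3 := ler_pM (n0 _) (n0 _) (ltW ya) (lexx (hnorm H p)).
have b4 := ler_pM (n0 _) (n0 _) Tale (ltW pb).
split.
  rewrite !ReD; apply: le_trans (ler_normD _ _) _.
  apply: le_trans (lerD (ler_normD _ _) (ler_normD _ _)) _.
  have := cauchy_schwarz HH Hxa Hq; have := cauchy_schwarz HH Ha Hqb.
  have := cauchy_schwarz HH Hya Hp; have := cauchy_schwarz HH HTa Hpb.
  by rewrite /rip => ? ? ? ?; lra.
rewrite !ImD; apply: le_trans (ler_normD _ _) _.
apply: le_trans (lerD (ler_normD _ _) (ler_normD _ _)) _.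
have := cauchy_schwarz_Im HH Hxa Hq; have := cauchy_schwarz_Im HH Ha Hqb.
have := cauchy_schwarz_Im HH Hya Hp; have := cauchy_schwarz_Im HH HTa Hpb.
by move=> ? ? ? ?; lra.
Qed.

Lemma analytic_essentially_skew_adjoint : essentially_skew_adjoint H D T.
Proof.
split=> //; first by split=> //; auto.
apply/seteqP; split=> -[x y] /=.
  exact: adjoint_sub_gclosure.
exact: gclosure_sub_adjoint.
Qed.

End EssentiallySkewAdjoint.

(** * Finitely supported sums and complex series *)

Lemma sum_nat_fin_supp (V : nmodType) (F : nat -> V) N n : (N <= n)%N ->
  (forall i, (N <= i)%N -> F i = 0) -> \sum_(0 <= i < n) F i = \sum_(i < N) F i.
Proof.
move=> Nn F0; rewrite (@big_cat_nat _ _ _ N) //= big_mkord.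
by rewrite (@big_nat_cond _ _ _ N) [X in _ + X]big1 ?addr0 // => i /andP[/andP[/F0]].
Qed.

Section ComplexSeries.
Context {R : realType}.
Local Notation C := R[i].

Lemma cvg_complex (a b : nat -> R) (la lb : R) :
  a @ \oo --> la -> b @ \oo --> lb ->
  ((fun n => a n +i* b n : C^o) @ \oo --> (la +i* lb : C^o)).
Proof.
(* In the order of the complex numbers a positive radius has zero imaginary part, so only its real
   part e remains. *)
move=> ha hb; apply/cvgrPdist_lt => -[e e'] /[dup]; rewrite ltcE /= => /andP[/eqP -> e0] _.
have e2 : 0 < e / 2 by rewrite divr_gt0.
move/cvgrPdist_lt: ha => /(_ _ e2) ha; move/cvgrPdist_lt: hb => /(_ _ e2) hb.
near=> n.
have an : `|la - a n| < e / 2 by near: n.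
have bn : `|lb - b n| < e / 2 by near: n.
rewrite normc_def /= ltcR.
rewrite -[ltRHS]ger0_norm ?(ltW e0) // -sqrtr_sqr ltr_sqrt ?exprn_gt0 //.
have small (x : R) : `|x| < e / 2 -> x ^+ 2 < e ^+ 2 / 4.
  move=> xe; rewrite -(real_normK (num_real x)).
  have -> : e ^+ 2 / 4 = (e / 2) ^+ 2 by field.
  by rewrite ltr_pXn2r ?nnegrE // ltW.
have := small _ an; have := small _ bn; have : 0 < e ^+ 2 by rewrite exprn_gt0.
by move=> ? ? ?; lra.
Unshelve. all: by end_near. Qed.

Lemma Re_sum (I : Type) (r : seq I) (F : I -> C) :
  complex.Re (\sum_(i <- r) F i) = \sum_(i <- r) complex.Re (F i).
Proof.
by elim: r => [|i r IH]; rewrite ?big_nil // !big_cons ReD IH.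
Qed.

Lemma Im_sum (I : Type) (r : seq I) (F : I -> C) :
  complex.Im (\sum_(i <- r) F i) = \sum_(i <- r) complex.Im (F i).
Proof.
by elim: r => [|i r IH]; rewrite ?big_nil // !big_cons ImD IH.
Qed.

Lemma cvg_complex_series (z : nat -> C) :
  cvgn (series (fun i => complex.Re (z i))) ->
  cvgn (series (fun i => complex.Im (z i))) ->
  (series (z : nat -> C^o) @ \oo --> (limn (series (fun i => complex.Re (z i))) +i*
    limn (series (fun i => complex.Im (z i))) : C^o)).
Proof.
move=> hr hi; have -> : series (z : nat -> C^o) =
  fun n => series (fun i => complex.Re (z i)) n +i* series (fun i => complex.Im (z i)) n.
  apply/funext => n; rewrite /series /= -Re_sum -Im_sum.
  by case: (\sum_(_ <= _ < _) _).
exact: cvg_complex.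
Qed.

Lemma lim_complex_series (z : nat -> C) :
  cvgn (series (fun i => complex.Re (z i))) ->
  cvgn (series (fun i => complex.Im (z i))) ->
  limn (series (z : nat -> C^o)) = limn (series (fun i => complex.Re (z i))) +i*
    limn (series (fun i => complex.Im (z i))).
Proof.
by move=> hr hi; apply: cvg_lim (cvg_complex_series hr hi); exact: norm_hausdorff.
Qed.

Lemma norm_le_cvg_series (u w : nat -> R) :
  (forall i, `|u i| <= w i) -> cvgn (series w) -> cvgn (series u).
Proof.
move=> uw hw; apply: normed_cvg.
apply: (series_le_cvg _ _ uw hw) => // i; exact: le_trans (normr_ge0 _) (uw i).
Qed.

End ComplexSeries.

(** * Square-summable sequences as an inner product space *)

Section Ell2.
Context {R : realType} {E : lmodType R[i]} {H : ipspace E}.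
Local Notation C := R[i].
Local Notation ell2 := (ell2 H).
Hypothesis HH : prehilbert H.

Let HH' := prehilbert_subspace HH.
Let H0 := subspace0 HH'.
Let HB := subspaceB HH'.
Let HN := subspaceN HH'.
Let HD := subspaceD HH'.
Let HZ := subspaceZ HH'.
#[local] Hint Resolve H0 HB HN HD HZ : core.

Let sq (u : nat -> E) i := hnorm H (u i) ^+ 2.

Lemma ell2_carrier u i : ell2 u -> H (u i).
Proof. by case. Qed.
#[local] Hint Resolve ell2_carrier : core.

Let sq_ge0 u i : 0 <= sq u i.
Proof. by rewrite /sq exprn_ge0 ?hnorm_ge0. Qed.

(** Comparison with the sum of the two squared-norm series, through ab <= a^2 + b^2 for nonnegative
    a and b. *)
Lemma cvg_ell2_bound u v (z : nat -> R) : ell2 u -> ell2 v ->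
  (forall i, `|z i| <= hnorm H (u i) * hnorm H (v i)) -> cvgn (series z).
Proof.
move=> [_ cu] [_ cv] zle.
apply: (@norm_le_cvg_series _ _ (sq u + sq v)); last exact: is_cvg_seriesD.
move=> i; apply: le_trans (zle i) _.
have a0 := hnorm_ge0 (H := H) (u i); have b0 := hnorm_ge0 (H := H) (v i).
rewrite -[leRHS]/(hnorm H (u i) ^+ 2 + hnorm H (v i) ^+ 2).
have := sqr_ge0 (hnorm H (u i) - hnorm H (v i)); have := mulr_ge0 a0 b0.
by rewrite sqrrB; lra.
Qed.

Lemma cvg_ell2_Re u v : ell2 u -> ell2 v ->
  cvgn (series (fun i => complex.Re (ip H (u i) (v i)))).
Proof.
move=> lu lv; apply: (cvg_ell2_bound lu lv) => i.
by apply: (cauchy_schwarz HH); auto.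
Qed.

Lemma cvg_ell2_Im u v : ell2 u -> ell2 v ->
  cvgn (series (fun i => complex.Im (ip H (u i) (v i)))).
Proof.
move=> lu lv; apply: (cvg_ell2_bound lu lv) => i.
by apply: (cauchy_schwarz_Im HH); auto.
Qed.

Lemma ip_ell2E u v : ell2 u -> ell2 v ->
  ip ell2 u v = limn (series (fun i => complex.Re (ip H (u i) (v i)))) +i*
                limn (series (fun i => complex.Im (ip H (u i) (v i)))).
Proof.
by move=> lu lv; apply: lim_complex_series; [exact: cvg_ell2_Re | exact: cvg_ell2_Im].
Qed.

Lemma cvg_ip_ell2 u v : ell2 u -> ell2 v ->
  (series (fun i => ip H (u i) (v i) : C^o) @ \oo --> (ip ell2 u v : C^o)).
Proof.
move=> lu lv; rewrite ip_ell2E //.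
by apply: cvg_complex_series; [exact: cvg_ell2_Re | exact: cvg_ell2_Im].
Qed.

Lemma ell2_finite_sum u v N : ell2 u -> ell2 v ->
  (forall i, (N <= i)%N -> ip H (u i) (v i) = 0) ->
  ip ell2 u v = \sum_(i < N) ip H (u i) (v i).
Proof.
move=> lu lv z; apply: (@cvg_unique C^o _ (series (fun i => ip H (u i) (v i) : C^o) @ \oo)).
- exact: norm_hausdorff.
- exact: cvg_ip_ell2.
apply: cvg_near_cst; exists N => // n /= Nn.
exact: sum_nat_fin_supp.
Qed.

Lemma ell2_subspace : linear_subspace (carrier ell2).
Proof.
split=> [|a f g [Hf cf] [Hg cg]].
  split=> [i|]; first exact: H0.
  rewrite (_ : (fun i => _) = fun=> 0); last first.
    by apply/funext => i; rewrite -[(0 : nat -> E) i]/(0 : E) hnorm0 // expr0n.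
  by rewrite /series /=; apply: is_cvg_near_cst; exists 0%N => // n _ /=; rewrite big1.
split=> [i|]; first by apply: HD => //; exact: HZ.
pose k := complex.Re a ^+ 2 + complex.Im a ^+ 2.
(* Here k is the squared modulus of a, and |a f + g|^2 <= 2 |a f|^2 + 2 |g|^2 coordinatewise. *)
apply: (@norm_le_cvg_series _ _ ((2 * k) *: (sq f : nat -> R^o) + 2 *: (sq g : nat -> R^o))).
  move=> i; rewrite ger0_norm ?exprn_ge0 ?hnorm_ge0 //.
  rewrite -[leRHS]/(2 * k * hnorm H (f i) ^+ 2 + 2 * hnorm H (g i) ^+ 2).
  have Haf : H (a *: f i) by auto.
  rewrite -mulrA -hnorm_sqrZ // -[(a *: f + g) i]/(a *: f i + g i).
  have := hnormD HH Haf (Hg i).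
  have := hnorm_ge0 (H := H) (a *: f i + g i); have := hnorm_ge0 (H := H) (a *: f i).
  have := hnorm_ge0 (H := H) (g i); set x := hnorm _ _; set y := hnorm _ _; set z := hnorm _ _.
  move=> x0 y0 z0 zle; have := sqr_ge0 (x - y).
  have : z ^+ 2 <= (y + x) ^+ 2 by rewrite lerXn2r ?nnegrE ?addr_ge0.
  by rewrite !expr2; lra.
by apply: is_cvg_seriesD; apply: is_cvg_seriesZ.
Qed.

Lemma ell2_ip_linear f g h (a : C) : ell2 f -> ell2 g -> ell2 h ->
  ip ell2 f (a *: g + h) = a * ip ell2 f g + ip ell2 f h.
Proof.
move=> lf lg lh; have lgh : ell2 (a *: g + h) by case: ell2_subspace => _; apply.
apply: (@cvg_unique C^o _ (series (fun i => ip H (f i) ((a *: g + h) i) : C^o) @ \oo)).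
- exact: norm_hausdorff.
- exact: cvg_ip_ell2.
rewrite (_ : series _ = (a \*: series (fun i => ip H (f i) (g i) : C^o)) +
   series (fun i => ip H (f i) (h i) : C^o)); last first.
  apply/funext => n; rewrite /series /= -[RHS]/(a * _ + _) mulr_sumr -big_split /=.
  apply: eq_bigr => i _; rewrite -[(a *: g + h) i]/(a *: g i + h i).
  by rewrite ipDr ?ipZr //; auto.
by apply: cvgD; [apply: cvgZl_tmp|]; exact: cvg_ip_ell2.
Qed.

Lemma ell2_ip_conj f g : ell2 f -> ell2 g -> ip ell2 g f = (ip ell2 f g)^*%C.
Proof.
move=> lf lg; rewrite !ip_ell2E //= -limN; last exact: cvg_ell2_Im.
congr (limn _ +i* limn _); apply/funext => n; rewrite /series /=.
  by apply: eq_bigr => i _; rewrite ip_conj ?Re_conjc //; auto.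
rewrite -[RHS]/(- _) -sumrN; apply: eq_bigr => i _.
by rewrite ip_conj //; auto; case: (ip H (f i) (g i)).
Qed.

Lemma ip_ell2_self u : ell2 u -> ip ell2 u u = (limn (series (sq u)))%:C.
Proof.
move=> lu; rewrite ip_ell2E //; congr (_ +i* _).
  by congr (limn (series _)); apply/funext => i; rewrite ip_self //; auto.
rewrite (_ : (fun i => _) = fun=> 0); last by apply/funext => i; rewrite ip_self //; auto.
apply: (@lim_near_cst R^o); first exact: norm_hausdorff.
by exists 0%N => // n _; rewrite /series /= big1.
Qed.

Lemma series_sq_le u n : ell2 u -> series (sq u) n <= limn (series (sq u)).
Proof.
move=> [_ cu]; apply: nondecreasing_cvgn_le => //.
by apply: nondecreasing_series => i _ _; exact: sq_ge0.
Qed.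

Lemma prehilbert_ell2 : prehilbert ell2.
Proof.
split; [exact: ell2_subspace | exact: ell2_ip_linear | exact: ell2_ip_conj |].
move=> f lf f0; rewrite ip_ell2_self // ltcR.
have [i fi] : exists i, f i != 0.
  apply: contrapT => /forallNP fz; move/eqP: f0; apply; apply/funext => i.
  by apply/eqP/negPn/negP; exact: fz.
apply: lt_le_trans (series_sq_le i.+1 lf).
rewrite /series /= big_nat_recr //=; apply: ltr_wpDl; first exact: sumr_ge0.
by rewrite /sq hnorm_sqr ?rip_gt0 //; auto.
Qed.

Lemma hnorm_ell2_sqr u : ell2 u -> hnorm ell2 u ^+ 2 = limn (series (sq u)).
Proof.
by move=> lu; rewrite (hnorm_sqr prehilbert_ell2) // /rip ip_ell2_self.
Qed.

Lemma fin_supp_ell2 u N : (forall i, H (u i)) -> (forall i, (N <= i)%N -> u i = 0) -> ell2 u.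
Proof.
move=> Hu u0; split=> //; rewrite /series /=; apply: is_cvg_near_cst.
exists N => // n /= Nn.
by apply: (sum_nat_fin_supp Nn) => i Ni; rewrite u0 // hnorm0 // expr0n.
Qed.

Lemma hnorm_ell2_fin_supp u N : (forall i, H (u i)) -> (forall i, (N <= i)%N -> u i = 0) ->
  hnorm ell2 u ^+ 2 = \sum_(i < N) hnorm H (u i) ^+ 2.
Proof.
move=> Hu u0; have lu := fin_supp_ell2 Hu u0.
rewrite (hnorm_sqr prehilbert_ell2) // /rip (@ell2_finite_sum u u N) //.
  by rewrite Re_sum; apply: eq_bigr => i _; rewrite ip_self.
by move=> i /u0 ->; rewrite ip0r.
Qed.

(** The l^1 sum on the right is additive in the coordinates, which is what lets the word estimates
    pass through a matrix of operators. *)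
Lemma hnorm_ell2_le_sum u N : (forall i, H (u i)) -> (forall i, (N <= i)%N -> u i = 0) ->
  hnorm ell2 u <= \sum_(i < N) hnorm H (u i).
Proof.
move=> Hu u0; rewrite -(@ler_pXn2r _ 2) ?nnegrE ?hnorm_ge0 ?sumr_ge0 //; last first.
  by move=> i _; exact: hnorm_ge0.
rewrite (hnorm_ell2_fin_supp Hu u0).
elim: N {u0} => [|N IH]; first by rewrite !big_ord0 expr0n.
rewrite !big_ord_recr /= sqrrD lerD2r; apply: le_trans IH _; rewrite lerDl.
by rewrite mulrn_wge0 // mulr_ge0 ?hnorm_ge0 ?sumr_ge0 // => i _; exact: hnorm_ge0.
Qed.

Definition truncate (N : nat) (u : nat -> E) : nat -> E := fun i => if (i < N)%N then u i else 0.

Lemma truncate_approx u e : ell2 u -> 0 < e ->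
  exists N, hnorm ell2 (u - truncate N u) < e.
Proof.
move=> lu e0; have [Hu cu] := lu.
have /cvgrPdist_lt/(_ (e ^+ 2)) := cu; rewrite exprn_gt0 // => /(_ isT) [N _ h].
exists N; have lt : ell2 (truncate N u).
  apply: (@fin_supp_ell2 _ N) => i; first by rewrite /truncate; case: ifP.
  by rewrite /truncate ltnNge => ->.
have lut : ell2 (u - truncate N u) by apply: (subspaceB ell2_subspace).
rewrite -(@ltr_pXn2r _ 2) ?nnegrE ?hnorm_ge0 ?ltW // hnorm_ell2_sqr //.
have := h N (leqnn N); apply: le_lt_trans; rewrite ger0_norm; last first.
  by rewrite subr_ge0; exact: series_sq_le.
apply: limr_le; first by case: lut.
exists N => // n /= Nn.
(* The first N coordinates of the difference vanish, so its partial sums are S_n - S_N, bounded by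
   the tail that [h] makes small. *)
apply: le_trans (_ : series (sq u) n - series (sq u) N <= _); last first.
  by rewrite lerD2r; exact: series_sq_le.
rewrite /series /= (@big_cat_nat _ _ _ N) //= [in leRHS](@big_cat_nat _ _ _ N 0 n) //=.
rewrite addrAC subrr add0r [X in X + _]big_nat big1 ?add0r => [|i /andP[_ iN]].
  rewrite !big_nat ler_sum // => i /andP[Ni _].
  by rewrite /sq /truncate -[(u - _) i]/(u i - _) ltnNge Ni subr0.
by rewrite /sq -[(u - _) i]/(u i - truncate N u i) /truncate iN subrr hnorm0 // expr0n.
Qed.

Lemma hdense_ell2 (D F : set _) : hdense H D ->
  (forall u N, (forall i, D (u i)) -> (forall i, (N <= i)%N -> u i = 0) -> F u) ->
  D 0 -> F `<=` carrier ell2 -> hdense ell2 F.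
Proof.
move=> Ddense DF D0 Fl; split=> // u lu e e0; have [Hu _] := lu.
have e2 : 0 < e / 2 by rewrite divr_gt0.
have [N uN] := truncate_approx lu e2.
(* Each of the N surviving coordinates gets an equal share of e/2; the divisor N + 1 also covers N =
   0. *)
have d0 : 0 < e / 2 / N.+1%:R by rewrite divr_gt0.
have /choice[g gP] i : exists g, D g /\ hnorm H (u i - g) < e / 2 / N.+1%:R.
  by have [g Dg gu] := hdense_approx Ddense (Hu i) d0; exists g.
have tg0 i : (N <= i)%N -> truncate N g i = 0 by rewrite /truncate ltnNge => ->.
have Ftg : F (truncate N g).
  by apply: (DF _ N) => // i; rewrite /truncate; case: ifP => // _; have [] := gP i.
exists (truncate N g) => //.
have ltg := Fl _ Ftg.
have ltu : ell2 (truncate N u).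
  apply: (@fin_supp_ell2 _ N) => i; first by rewrite /truncate; case: ifP.
  by rewrite /truncate ltnNge => ->.
have lB := subspaceB ell2_subspace.
have -> : u - truncate N g = (u - truncate N u) + (truncate N u - truncate N g).
  by rewrite addrA subrK.
apply: le_lt_trans (hnormD prehilbert_ell2 _ _) _; [exact: lB | exact: lB |].
suff : hnorm ell2 (truncate N u - truncate N g) <= e / 2 by lra.
apply: le_trans (@hnorm_ell2_le_sum _ N _ _) _.
- by move=> i; case: (lB _ _ ltu ltg).
- move=> i Ni; rewrite -[LHS]/(truncate N u i - truncate N g i) tg0 //.
  by rewrite /truncate ltnNge Ni subr0.
apply: (@le_trans _ _ (\sum_(i < N) e / 2 / N.+1%:R)).
  apply: ler_sum => i _; rewrite -[(_ - _) _]/(truncate N u i - truncate N g i).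
  by rewrite /truncate ltn_ord; have [_ /ltW] := gP i.
rewrite sumr_const card_ord -[_ *+ N]mulr_natr -mulrA ler_piMr ?(ltW e2) //.
by rewrite mulrC ler_pdivrMr // mul1r ler_nat.
Qed.

End Ell2.

(** * The algebraic tensor product in coordinates *)

Definition fin_supp_in (R : realType) (E : lmodType R[i]) (D : set E) (u : nat -> E) : Prop :=
  (forall i, D (u i)) /\ exists N, forall i, (N <= i)%N -> u i = 0.

Lemma sum_delta_scale (R : nzRingType) (E : lmodType R) (F : nat -> E) n j :
  (forall i, (n <= i)%N -> F i = 0) -> \sum_(i < n) (i == j :> nat)%:R *: F i = F j.
Proof.
move=> F0; have [jn|nj] := ltnP j n.
  rewrite (bigD1 (Ordinal jn)) //= eqxx scale1r big1 ?addr0 // => i ij.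
  by rewrite (negbTE (ij : (i != j :> nat))) scale0r.
rewrite F0 // big1 // => i _; rewrite ltn_eqF ?scale0r //.
exact: leq_trans (ltn_ord i) nj.
Qed.

(** A finite sum of tensors has support bounded by the largest of the finitely many supports;
    conversely u is the sum of the tensors of its entries u_k with the basis vectors e_k. *)
Lemma alg_tensorE (R : realType) (E : lmodType R[i]) (D : set E) :
  linear_subspace D -> alg_tensor D = fin_supp_in D.
Proof.
move=> DD; apply/seteqP; split=> u.
  move=> [m [a [f [/choice[N NP] Df ->]]]].
  have sumE i : (\sum_(k < m) tensor (a k) (f k)) i = \sum_(k < m) a k i *: f k.
    by rewrite fct_sumE.
  split=> [i|].
    by rewrite sumE; apply: (subspace_sum DD) => k; exact: (subspaceZ DD).
  exists (\max_k N k)%N => i Ni; rewrite sumE big1 // => k _.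
  by rewrite NP ?scale0r // (leq_trans _ Ni) // leq_bigmax.
move=> [Du [N uN]].
exists N, (fun k : 'I_N => unit_seq k), (fun k : 'I_N => u k); split=> // [k|].
  by exists k.+1 => i ki; rewrite /unit_seq ltn_eqF.
apply/funext => j; rewrite fct_sumE /tensor /unit_seq.
by rewrite sum_delta_scale.
Qed.

(** * The operator L for an abstract pair V, W of formal adjoints *)

Section Tridiagonal.
Context {R : realType} {E : lmodType R[i]} {H : ipspace E} {D : set E} {V W : E -> E}.
Local Notation C := R[i].
Hypothesis HH : prehilbert H.
Hypothesis DD : linear_subspace D.
Hypothesis Ddense : hdense H D.
Hypothesis VD : forall f, D f -> D (V f).
Hypothesis WD : forall f, D f -> D (W f).
Hypothesis Vlin : forall (a : C) f g, D f -> D g -> V (a *: f + g) = a *: V f + V g.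
Hypothesis Wlin : forall (a : C) f g, D f -> D g -> W (a *: f + g) = a *: W f + W g.
Hypothesis VW : forall f g, D f -> D g -> ip H f (V g) = ip H (W f) g.

Let DH : forall f, D f -> H f := fun f => @hdense_sub _ _ _ D f Ddense.
Let HH' := prehilbert_subspace HH.
Let D0 := subspace0 DD.
Let addD := subspaceD DD.
Let oppD := subspaceN DD.
Let subD := subspaceB DD.
Let scaleD := subspaceZ DD.
Let HB := subspaceB HH'.
Let HN := subspaceN HH'.
Let HD := subspaceD HH'.
Let HZ := subspaceZ HH'.
#[local] Hint Resolve D0 addD oppD subD scaleD DH VD WD HB HN HD HZ : core.

Let S f := (2^-1 : C) *: (V f + W f).
Let A f := (2^-1 : C) *: (V f - W f).

Lemma ip_adjoint_sym f g : D f -> D g -> ip H f (W g) = ip H (V f) g.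
Proof. by move=> Df Dg; rewrite (ip_conj HH) -?VW -?(ip_conj HH); auto. Qed.

Lemma half_real_complex : (2^-1 : C) = (2^-1 : R)%:C.
Proof. by rewrite fmorphV rmorph_nat. Qed.

Lemma half_split (f : E) : (2^-1 : C) *: f + (2^-1 : C) *: f = f.
Proof.
rewrite -scalerDl -[RHS]scale1r; congr (_ *: _).
by rewrite -[RHS](@mulfV _ (2 : C)) ?pnatr_eq0 // mulr2n mulrDl mul1r.
Qed.

Lemma sym_part_on f : D f -> D (S f). Proof. by rewrite /S; auto. Qed.
Lemma skew_part_on f : D f -> D (A f). Proof. by rewrite /A; auto. Qed.
#[local] Hint Resolve sym_part_on skew_part_on : core.

Lemma sym_part_linear a f g : D f -> D g -> S (a *: f + g) = a *: S f + S g.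
Proof.
move=> Df Dg; rewrite /S Vlin // Wlin // scalerA mulrC -scalerA -scalerDr.
by congr (_ *: _); rewrite scalerDr addrACA.
Qed.

Lemma skew_part_linear a f g : D f -> D g -> A (a *: f + g) = a *: A f + A g.
Proof.
move=> Df Dg; rewrite /A Vlin // Wlin // scalerA mulrC -scalerA -scalerDr.
by congr (_ *: _); rewrite opprD addrACA scalerBr.
Qed.

Let S0 : S 0 = 0 := linear_on0 DD sym_part_linear.
Let A0 : A 0 = 0 := linear_on0 DD skew_part_linear.

Lemma sym_skew_partD f : S f + A f = V f.
Proof. by rewrite /S /A -scalerDr addrACA subrr addr0 scalerDr half_split. Qed.

Lemma ip_sym_part f g : D f -> D g -> ip H f (S g) = ip H (S f) g.
Proof.
move=> Df Dg; rewrite /S half_real_complex ipZr ?ipZl // ?ipDr ?ipDl //; auto.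
by rewrite conjc_real VW // ip_adjoint_sym // [_ + ip H (V f) g]addrC.
Qed.

Lemma ip_skew_part f g : D f -> D g -> ip H f (A g) = - ip H (A f) g.
Proof.
move=> Df Dg; rewrite /A half_real_complex ipZr ?ipZl // ?ipBr ?ipBl //; auto.
by rewrite conjc_real VW // ip_adjoint_sym // -mulrN opprB.
Qed.

(** L read row by row, which replaces the limit in [hsum] by a coordinate formula; row 0 has no
    entry below the diagonal. *)
Definition tridiagonal (u : nat -> E) : nat -> E :=
  fun i => S (u i.+1) + A (u i) - (if i is j.+1 then S (u j) else 0).
Local Notation T := tridiagonal.

Lemma tridiagonal_supp u N : (forall i, (N <= i)%N -> u i = 0) ->
  forall i, (N < i)%N -> T u i = 0.
Proof.
move=> uN [//|i] Ni; rewrite /tridiagonal !uN ?S0 ?A0 ?addr0 ?subr0 //.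
- exact: ltnW.
- exact/ltnW/ltnW.
Qed.

Lemma tridiagonal_in u : fin_supp_in D u -> fin_supp_in D (T u).
Proof.
move=> [Du [N uN]]; split=> [i|]; last by exists N.+1; exact: tridiagonal_supp.
by rewrite /tridiagonal; case: i => [|i]; auto.
Qed.

Lemma fin_supp_in_subspace : linear_subspace (fin_supp_in D).
Proof.
split=> [|a f g [Df [M fM]] [Dg [N gN]]]; first by split; [move=> i; exact: D0 | exists 0%N].
split=> [i|]; first by case: DD => _; apply.
exists (maxn M N) => i; rewrite geq_max => /andP[Mi Ni].
by rewrite -[LHS]/(a *: f i + g i) fM // gN // scaler0 addr0.
Qed.

Lemma fin_supp_in_ell2 u : fin_supp_in D u -> ell2 H u.
Proof. by move=> [Du [N uN]]; apply: (fin_supp_ell2 HH) uN => i; auto. Qed.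

Lemma tridiagonal_linear a f g : fin_supp_in D f -> fin_supp_in D g ->
  T (a *: f + g) = a *: T f + T g.
Proof.
move=> [Df _] [Dg _]; apply/funext => i.
rewrite -[RHS]/(a *: T f i + T g i) /tridiagonal.
have E' j : (a *: f + g) j = a *: f j + g j by [].
rewrite !E' sym_part_linear // skew_part_linear //.
case: i => [|i]; rewrite ?E' ?sym_part_linear // ?scalerBr ?scalerDr ?scaler0 ?oppr0 ?subr0 ?addr0.
  by rewrite addrACA.
by rewrite opprD [RHS]addrACA; congr (_ + _); rewrite addrACA.
Qed.

(** S is symmetric and A antisymmetric, while the two off-diagonals carry S and -S. Moving the
    operator to the other side therefore exchanges the sums of X and Z and changes the sign of that
    of Y. *)
Lemma tridiagonal_antisymmetric : antisymmetric_on (ell2 H) (fin_supp_in D) T.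
Proof.
move=> f g ff fg.
have lf := fin_supp_in_ell2 ff; have lg := fin_supp_in_ell2 fg.
have lTf := fin_supp_in_ell2 (tridiagonal_in ff).
have lTg := fin_supp_in_ell2 (tridiagonal_in fg).
have [Df [N1 fN1]] := ff; have [Dg [N2 gN2]] := fg.
pose N := maxn N1 N2.
have fN i : (N <= i)%N -> f i = 0 by rewrite geq_max => /andP[/fN1].
have gN i : (N <= i)%N -> g i = 0 by rewrite geq_max => /andP[_ /gN2].
rewrite (@ell2_finite_sum _ _ _ HH f (T g) N.+1) //; last first.
  by move=> i /ltnW /fN ->; rewrite ip0l //; exact: (ell2_carrier _ lTg).
rewrite (@ell2_finite_sum _ _ _ HH (T f) g N.+1) //; last first.
  by move=> i /ltnW /gN ->; rewrite ip0r //; exact: (ell2_carrier _ lTf).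
pose X i := ip H (f i) (S (g i.+1)).
pose Y i := ip H (f i) (A (g i)).
pose Z i := ip H (f i.+1) (S (g i)).
have sumL : \sum_(i < N.+1) ip H (f i) (T g i) =
    \sum_(i < N.+1) X i + \sum_(i < N.+1) Y i - \sum_(i < N) Z i.
  rewrite [X in _ = _ - X](_ : _ =
      \sum_(i < N.+1) (if i : nat is j.+1 then Z j else 0)); last first.
    by rewrite big_ord_recl add0r.
  rewrite -sumrN -!big_split /=; apply: eq_bigr => -[[|i] /= _] _.
    by rewrite /tridiagonal !subr0 ipDr //; auto.
  by rewrite /tridiagonal ipBr ?ipDr //; auto.
have sumR : \sum_(i < N.+1) ip H (T f i) (g i) =
    \sum_(i < N.+1) Z i - \sum_(i < N.+1) Y i - \sum_(i < N) X i.
  rewrite [X in _ = _ - X](_ : _ =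
      \sum_(i < N.+1) (if i : nat is j.+1 then X j else 0)); last first.
    by rewrite big_ord_recl add0r.
  rewrite -!sumrN -!big_split /=; apply: eq_bigr => -[[|i] /= _] _.
    rewrite /tridiagonal !subr0 ipDl //; auto.
    by rewrite /Z ip_sym_part // /Y ip_skew_part // opprK.
  rewrite /tridiagonal ipBl ?ipDl //; auto.
  by rewrite /Z ip_sym_part // /Y ip_skew_part // opprK /X ip_sym_part.
(* The two sides now differ only in the boundary terms X N and Z N, which vanish because f is zero
   from N on. *)
rewrite sumL sumR ![in LHS]big_ord_recr ![in RHS]big_ord_recr /=.
have -> : X N = 0 by rewrite /X fN // ip0l //; auto.
have -> : Z N = 0 by rewrite /Z fN // ip0l //; auto.
by ring.
Qed.

(** [hsum] selects some limit, so uniqueness has to be shown: for another limit l, the eventually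
    constant sequence |s - l| tends to 0. *)
Lemma hsum_fin_supp (t : nat -> nat -> E) s N : ell2 H s -> (forall i, ell2 H (t i)) ->
  (forall n, (N <= n)%N -> \sum_(i < n) t i = s) -> hsum (ell2 H) t = s.
Proof.
move=> ls lt ts; apply: xget_unique => [|l [ll hl]].
  split=> //; apply: cvg_near_cst; exists N => // n /= /ts ->.
  by rewrite subrr (hnorm0 (prehilbert_ell2 HH)).
have lsl : ell2 H (s - l) by apply: (subspaceB (ell2_subspace HH)).
apply/esym/eqP; rewrite -subr_eq0; apply/eqP.
apply: (hnorm_eq0 (prehilbert_ell2 HH)) => //.
apply: cvg_unique hl; first exact: norm_hausdorff.
by apply: cvg_near_cst; exists N => // n /= /ts ->.
Qed.

Lemma Lop_tridiagonal u : fin_supp_in D u -> Lop H S A u = T u.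
Proof.
move=> fu; have [Du [N uN]] := fu.
have mu i j B : (forall f, D f -> D (B f)) -> ell2 H (munit_tensor i j B u).
  move=> BD; apply: fin_supp_in_ell2; split=> [k|]; first by apply: scaleD; auto.
  exists i.+1 => k ik; rewrite /munit_tensor /tensor /unit_seq ltn_eqF //.
  exact: scale0r.
have lB := subspaceB (ell2_subspace HH); have lD := subspaceD (ell2_subspace HH).
apply: (@hsum_fin_supp _ _ N).
- exact/fin_supp_in_ell2/tridiagonal_in.
- by move=> i; apply: lB; first apply: lD; apply: mu; auto.
move=> n Nn; apply/funext => j; rewrite fct_sumE.
have un i : (n <= i)%N -> u i = 0 by move=> ni; apply/uN/(leq_trans Nn).
rewrite (eq_bigr (fun i : 'I_n => (i == j :> nat)%:R *: S (u i.+1) +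
  (i == j :> nat)%:R *: A (u i) - (i.+1 == j :> nat)%:R *: S (u i))); last by [].
rewrite sumrB big_split /= (@sum_delta_scale _ _ (fun i => S (u i.+1))); last first.
  by move=> i ni; rewrite un ?S0 // leqW.
rewrite (@sum_delta_scale _ _ (fun i => A (u i))); last by move=> i /un ->; exact: A0.
(* The lower off-diagonal selects i + 1 = j, which has no solution for j = 0. *)
rewrite /tridiagonal; congr (_ - _); case: j => [|j].
  by rewrite big1 // => i _; rewrite scale0r.
rewrite -[RHS](@sum_delta_scale _ _ (fun i => S (u i)) n) // => i /un ->.
exact: S0.
Qed.

(** The norms of w f summed over all 2^n words w of length n in V and W; the recursion fixes the
    letter applied first. *)
Fixpoint word_norm_sum (n : nat) (f : E) : R :=
  if n is m.+1 then word_norm_sum m (V f) + word_norm_sum m (W f) else hnorm H f.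
Local Notation wsum := word_norm_sum.

Lemma wsum_ge0 n f : 0 <= wsum n f.
Proof. by elim: n f => [|n IH] f /=; rewrite ?hnorm_ge0 // addr_ge0. Qed.

Lemma wsumD n f g : D f -> D g -> wsum n (f + g) <= wsum n f + wsum n g.
Proof.
elim: n f g => [|n IH] f g Df Dg /=; first by apply: (hnormD HH); auto.
rewrite (linear_onD Vlin) // (linear_onD Wlin) // addrACA.
by apply: lerD; apply: IH; auto.
Qed.

Lemma wsumZ n (a : R) f : D f -> wsum n (a%:C *: f) = `|a| * wsum n f.
Proof.
elim: n f => [|n IH] f Df /=; first by apply: (hnormZ HH); auto.
by rewrite (linear_onZ DD Vlin) // (linear_onZ DD Wlin) // !IH ?mulrDr; auto.
Qed.

Lemma wsumN n f : D f -> wsum n (- f) = wsum n f.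
Proof.
move=> Df; have := wsumZ n (-1) Df; rewrite normrN1 mul1r => <-.
by rewrite rmorphN scaleN1r.
Qed.

Lemma wsum0 n : wsum n 0 = 0.
Proof. by have := wsumZ n 0 D0; rewrite scaler0 normr0 mul0r. Qed.

Lemma wsumS_le n f : D f -> wsum n (S f) <= 2^-1 * wsum n.+1 f.
Proof.
move=> Df; rewrite /S half_real_complex wsumZ; last by auto.
by rewrite ger0_norm ?invr_ge0 // ler_wpM2l ?invr_ge0 //=; apply: wsumD; auto.
Qed.

Lemma wsumA_le n f : D f -> wsum n (A f) <= 2^-1 * wsum n.+1 f.
Proof.
move=> Df; rewrite /A half_real_complex wsumZ; last by auto.
rewrite ger0_norm ?invr_ge0 // ler_wpM2l ?invr_ge0 //= -(wsumN n (WD Df)).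
by apply: wsumD; auto.
Qed.

(** Each u_i enters at most three rows of T u, every time through S or A. Either one costs a factor
    1/2 when expanded into V and W, whence 3/2. *)
Lemma wsum_tridiagonal_le n u N : (forall i, D (u i)) -> (forall i, (N <= i)%N -> u i = 0) ->
  \sum_(i < N.+1) wsum n (T u i) <= 3 / 2 * \sum_(i < N) wsum n.+1 (u i).
Proof.
move=> Du uN; set s := \sum_(i < N) _.
have s_eq M : (N <= M)%N -> \sum_(i < M) wsum n.+1 (u i) = s.
  move=> NM; rewrite -(big_mkord xpredT (fun i => wsum n.+1 (u i))).
  by apply: sum_nat_fin_supp => // i /uN ->; exact: wsum0.
have term i : wsum n (T u i) <= 2^-1 * wsum n.+1 (u i.+1) + 2^-1 * wsum n.+1 (u i) +
    (if i is j.+1 then 2^-1 * wsum n.+1 (u j) else 0).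
  rewrite /tridiagonal; case: i => [|i].
    rewrite subr0 addr0; apply: le_trans (wsumD _ _ _) _; auto.
    by apply: lerD; [exact: wsumS_le | exact: wsumA_le].
  apply: le_trans (wsumD _ _ _) _; auto; rewrite wsumN; last by auto.
  apply: lerD; last exact: wsumS_le.
  apply: le_trans (wsumD _ _ _) _; auto.
  by apply: lerD; [exact: wsumS_le | exact: wsumA_le].
apply: le_trans (ler_sum _ (fun i _ => term (i : 'I_N.+1))) _.
have last_eq : \sum_(i < N.+1)
    (if i : nat is j.+1 then 2^-1 * wsum n.+1 (u j) else 0) = 2^-1 * s.
  by rewrite big_ord_recl add0r mulr_sumr.
rewrite !big_split /= last_eq -!mulr_sumr s_eq //.
have : \sum_(i < N.+1) wsum n.+1 (u i.+1) <= s.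
  by rewrite -(s_eq N.+2 (leqW (leqnSn N))) [leRHS]big_ord_recl lerDr wsum_ge0.
by rewrite -/s; move: (\sum_(i < N.+1) _) => s'; lra.
Qed.

Lemma hnorm_iter_tridiagonal n u N : (forall i, D (u i)) -> (forall i, (N <= i)%N -> u i = 0) ->
  hnorm (ell2 H) (iter n T u) <= (3 / 2) ^+ n * \sum_(i < N) wsum n (u i).
Proof.
elim: n u N => [|n IH] u N Du uN.
  by rewrite mul1r; apply: (hnorm_ell2_le_sum HH) => // i; auto.
have [DTu _] : fin_supp_in D (T u) by apply: tridiagonal_in; split=> //; exists N.
rewrite iterSr; apply: le_trans (IH _ N.+1 DTu (tridiagonal_supp uN)) _.
rewrite exprSr -mulrA ler_wpM2l ?wsum_tridiagonal_le // exprn_ge0 // divr_ge0.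
Qed.

Hypothesis wsum_analytic : forall f, D f -> exists r c : R, [/\ 0 < r, 0 <= c &
  forall n, wsum n f <= c * n`!%:R * r ^+ n].

(** Each entry of u has its own radius; as there are finitely many entries, sums of the constants r
    and c serve for all of them at once. *)
Lemma tridiagonal_analytic u : fin_supp_in D u ->
  exists2 r : R, 0 < r & @analytic_on R _ (ell2 H) (fin_supp_in D) T r u.
Proof.
move=> fu; have [Du [N uN]] := fu.
suff [r [c [r0 c0 rc]]] : exists r c : R, [/\ 0 < r, 0 <= c &
    forall n, \sum_(i < N) wsum n (u i) <= c * n`!%:R * r ^+ n].
  have h0 : 0 < (3 / 2 : R) by rewrite divr_gt0.
  exists (3 / 2 * r); first by rewrite mulr_gt0.
  split=> //; exists c, 0%N; split=> // n.
  apply: le_trans (hnorm_iter_tridiagonal n Du uN) _.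
  by rewrite addn0 [(3 / 2 * r) ^+ n]exprMn [leRHS]mulrCA ler_wpM2l.
elim: N {uN} => [|N [r [c [r0 c0 rc]]]].
  by exists 1, 0; split=> // n; rewrite big_ord0 !mul0r.
have [r' [c' [r0' c0' rc']]] := wsum_analytic (Du N).
exists (r + r'), (c + c'); split; rewrite ?addr_gt0 ?addr_ge0 // => n.
rewrite big_ord_recr /= !mulrDl; apply: lerD.
  apply: le_trans (rc n) _; rewrite ler_wpM2l ?mulr_ge0 //.
  by rewrite lerXn2r ?nnegrE ?addr_ge0 ?ltW // ltrDl.
apply: le_trans (rc' n) _; rewrite ler_wpM2l ?mulr_ge0 //.
by rewrite lerXn2r ?nnegrE ?addr_ge0 ?ltW // ltrDr.
Qed.

Lemma tridiagonal_dense : hdense (ell2 H) (fin_supp_in D).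
Proof.
apply: (hdense_ell2 HH Ddense) => //; last exact: fin_supp_in_ell2.
by move=> u N Du uN; split=> //; exists N.
Qed.

Lemma Lop_essentially_skew_adjoint :
  essentially_skew_adjoint (ell2 H) (alg_tensor D) (Lop H S A).
Proof.
rewrite (alg_tensorE DD).
have LT := Lop_tridiagonal; have sub := fin_supp_in_subspace.
have fsZ a f g : fin_supp_in D f -> fin_supp_in D g -> fin_supp_in D (a *: f + g).
  by case: sub => _; apply.
apply: (analytic_essentially_skew_adjoint (prehilbert_ell2 HH) sub tridiagonal_dense).
- by move=> f ff; rewrite LT //; exact: tridiagonal_in.
- move=> a f g ff fg; rewrite !LT //; last exact: fsZ.
  exact: tridiagonal_linear.
- by move=> f g ff fg; rewrite !LT //; exact: tridiagonal_antisymmetric.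
move=> q fq; have [r r0 [_ [c [j [c0 cP]]]]] := tridiagonal_analytic fq.
exists r => //; split=> //; exists c, j; split=> // n.
have [-> _] : iter n (Lop H S A) q = iter n T q /\ fin_supp_in D (iter n T q).
  elim: n => //= n [-> fn]; split; last exact: tridiagonal_in.
  exact: LT.
exact: cP.
Qed.

Lemma fib_embedE n (f : E) i : fib_embed n f i = if (i < n)%N then (fib i.+1)%:R *: f else 0.
Proof.
rewrite /fib_embed fct_sumE.
rewrite (eq_bigr (fun k : 'I_n => (k == i :> nat)%:R *:
  (if (k < n)%N then (fib k.+1)%:R *: f else 0))); last first.
  by move=> k _; rewrite ltn_ord [RHS]scalerA mulrC -scalerA.
by rewrite (@sum_delta_scale _ _ (fun k => if (k < n)%N then (fib k.+1)%:R *: f else 0)) // =>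
  k; rewrite leqNgt => /negbTE ->.
Qed.

(** Row i reads coordinate i + 1, so each application of T shortens by one the initial segment on
    which the entries follow the Fibonacci pattern. *)
Lemma tridiagonal_fib u f n : fin_supp_in D u -> D f ->
  (forall i, (i < n)%N -> u i = (fib i.+1)%:R *: f) ->
  forall i, (i.+1 < n)%N -> T u i = (fib i.+1)%:R *: V f.
Proof.
move=> [Du _] Df uf i i1n; have iln := ltnW i1n.
have SZ a : S (a *: f) = a *: S f := linear_onZ DD sym_part_linear a Df.
have AZ a : A (a *: f) = a *: A f := linear_onZ DD skew_part_linear a Df.
rewrite /tridiagonal !uf // SZ AZ -sym_skew_partD scalerDr.
(* F_0 = 0 accounts for the missing neighbour of row 0. *)
have -> : (if i is j.+1 then S (u j) else 0) = (fib i)%:R *: S f.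
  case: i i1n iln => [|i] i1n iln; first by rewrite scale0r.
  by rewrite uf ?SZ // ltnW.
rewrite addrAC -scalerBl; congr (_ *: _ + _).
by rewrite -[fib i.+2]/(fib i.+1 + fib i)%N natrD addrK.
Qed.

Lemma proj1_iter_Lop n m f : (m < n)%N -> D f ->
  Defs.proj1 (iter m (Lop H S A) (fib_embed n f)) = iter m V f.
Proof.
move=> mn Df.
(* The induction needs the whole segment i < n - m, not just the first coordinate; m < n keeps i = 0
   inside it, where the factor is F_1 = 1. *)
suff [_ h] : fin_supp_in D (iter m (Lop H S A) (fib_embed n f)) /\
    forall i, (i < n - m)%N ->
      iter m (Lop H S A) (fib_embed n f) i = (fib i.+1)%:R *: iter m V f.
  by rewrite /Defs.proj1 h ?subn_gt0 // scale1r.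
elim: m {mn} => [|m [fm IH]] /=.
  split=> [|i]; last by rewrite subn0 fib_embedE => ->.
  split=> [i|]; first by rewrite fib_embedE; case: ifP => _; auto.
  by exists n => i; rewrite fib_embedE ltnNge => ->.
rewrite Lop_tridiagonal //; split; first exact: tridiagonal_in.
move=> i; rewrite subnS ltn_predRL; apply: (tridiagonal_fib fm _ IH).
exact: (iter_on VD).
Qed.

End Tridiagonal.

(** * Factorial growth of word sums from joint analyticity *)

(** [foldr] applies the letter of the last index first, so a word of length n + 1 is split at
    [ord_max] to match the recursion of [word_norm_sum]. *)
Lemma sum_word_norm (R : realType) (E : lmodType R[i]) (H : ipspace E)
    (Ts : 'I_2 -> E -> E) n f :
  \sum_(eps : {ffun 'I_n -> 'I_2}) hnorm H (foldr (fun i g => Ts (eps i) g) f (enum 'I_n)) =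
  word_norm_sum (H := H) (V := Ts ord0) (W := Ts ord_max) n f.
Proof.
elim: n f => [|n IH] f.
  rewrite (eq_bigr (fun _ => hnorm H f)) => [|eps _]; last by rewrite enum_ord0.
  by rewrite sumr_const card_ffun !card_ord expn0 mulr1n.
pose extend (p : 'I_2 * {ffun 'I_n -> 'I_2}) : {ffun 'I_n.+1 -> 'I_2} :=
  [ffun i => if unlift ord_max i is Some j then p.2 j else p.1].
pose restrict (e : {ffun 'I_n.+1 -> 'I_2}) : 'I_2 * {ffun 'I_n -> 'I_2} :=
  (e ord_max, [ffun j => e (lift ord_max j)]).
rewrite (reindex extend) /=; last first.
  exists restrict => [[a g] _ | e _]; rewrite /extend /restrict /=.
    congr pair; first by rewrite ffunE unlift_none.
    by apply/ffunP => j; rewrite !ffunE liftK.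
  by apply/ffunP => i; rewrite ffunE; case: unliftP => [j|] -> /=; rewrite ?ffunE.
have step p : foldr (fun i g => Ts (extend p i) g) f (enum 'I_n.+1) =
    foldr (fun i g => Ts (p.2 i) g) (Ts p.1 f) (enum 'I_n).
  rewrite enum_ordSr foldr_rcons ffunE unlift_none; elim: (enum 'I_n) => //= j s ->.
  by rewrite ffunE (_ : widen_ord _ j = lift ord_max j) ?liftK //; exact/val_inj/esym/lift_max.
under eq_bigr do rewrite step.
rewrite -(pair_bigA _ (fun a (g : {ffun 'I_n -> 'I_2}) =>
  hnorm H (foldr (fun i h => Ts (g i) h) (Ts a f) (enum 'I_n)))) /=.
by rewrite big_ord_recl big_ord1 !IH /=; congr (_ + word_norm_sum _ (Ts _ f)); apply/val_inj.
Qed.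

(** A Cauchy estimate: at z = r/2 the terms of the convergent series tend to 0, hence are at most 1
    from some N on. The sum of the earlier terms is added to the constant c, and the growth rate is
    2/r. *)
Lemma jointly_analytic_bound (R : realType) (E : lmodType R[i]) (H : ipspace E) (D : set E)
    (Ts : 'I_2 -> E -> E) f : jointly_analytic H D Ts -> D f ->
  exists r c : R, [/\ 0 < r, 0 <= c & forall n,
    word_norm_sum (H := H) (V := Ts ord0) (W := Ts ord_max) n f <= c * n`!%:R * r ^+ n].
Proof.
move=> ja Df; have [r r0 rP] := ja f Df.
have r2 : 0 < r / 2 by rewrite divr_gt0.
have zr : `|(r / 2)%:C| < r%:C :> R[i].
  by rewrite normc_def /= expr0n addr0 sqrtr_sqr gtr0_norm // ltcR ltr_pdivrMr // ltr_pMr // ltr1n.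
pose w n := word_norm_sum (H := H) (V := Ts ord0) (W := Ts ord_max) n f.
have w0 n : 0 <= w n by exact: wsum_ge0.
have fact0 n : 0 < n`!%:R :> R by rewrite ltr0n fact_gt0.
pose s n : R := (r / 2) ^+ n / n`!%:R * w n.
have s0 n : 0 <= s n by rewrite mulr_ge0 // divr_ge0 ?exprn_ge0 // ltW.
have /(cvg_series_cvg_0 (V := R[i]^o))/cvgrPdist_lt/(_ 1 ltr01)[N _ h] := rP _ zr.
have sle n : (N <= n)%N -> s n <= 1.
  move=> Nn; have := h n Nn; rewrite sub0r normrN sum_word_norm -/(w n).
  have -> : (r / 2)%:C ^+ n / n`!%:R * (w n)%:C = (s n)%:C.
    by rewrite /s !(rmorphM, rmorphXn, fmorphV, rmorph_nat).
  rewrite normc_def /= expr0n addr0 sqrtr_sqr ger0_norm //.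
  by rewrite -[1]/(1%:C) ltcR => /ltW.
have ri0 : 0 < (r / 2)^-1 by rewrite invr_gt0.
exists (r / 2)^-1, (1 + \sum_(n < N) s n); split=> // [|n].
  by rewrite addr_ge0 // sumr_ge0.
rewrite -/(w n); have -> : w n = s n * n`!%:R * (r / 2)^-1 ^+ n.
  have p0 : (r / 2) ^+ n != 0 by rewrite expf_neq0 // gt_eqF.
  rewrite /s exprVn mulrAC; move: ((r / 2) ^+ n) p0 => p p0.
  by field; rewrite p0 gt_eqF.
rewrite ler_wpM2r ?exprn_ge0 ?(ltW ri0) // ler_wpM2r ?(ltW (fact0 n)) //.
have [Nn|nN] := leqP N n.
  by apply: le_trans (sle n Nn) _; rewrite lerDl sumr_ge0.
apply: ler_wpDl => //; rewrite (bigD1 (Ordinal nN)) //= lerDl sumr_ge0 //.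
Qed.

Lemma word_norm_sumC (R : realType) (E : lmodType R[i]) (H : ipspace E) (V W : E -> E) n f :
  word_norm_sum (H := H) (V := V) (W := W) n f = word_norm_sum (H := H) (V := W) (W := V) n f.
Proof. by elim: n f => [|n IH] f //=; rewrite !IH addrC. Qed.

(** Exchanging V and W fixes S and changes the sign of A, which is the only difference between the
    two operators. *)
Lemma Lplus_swap (R : realType) (E : lmodType R[i]) (H : ipspace E) (V W : E -> E) :
  Lplus H (fun f => 2^-1 *: (V f + W f)) (fun f => 2^-1 *: (V f - W f)) =
  Lop H (fun f => 2^-1 *: (W f + V f)) (fun f => 2^-1 *: (W f - V f)).
Proof.
have -> : (fun f => 2^-1 *: (W f + V f)) = (fun f => 2^-1 *: (V f + W f)).
  by apply/funext => f; congr (_ *: _); exact: addrC.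
apply/funext => u; congr hsum; apply/funext => i; congr (_ + _ - _).
by apply/funext => j; rewrite /munit_tensor /tensor -[W _ - _]opprB !scalerN.
Qed.

(** * Complex linearity of the derivation and of its adjoint *)

Section Derivation.
Context {R : realType} {d : nat} {X : topologicalType} {atlas : set (@chart R d X)}.
Context {v : X -> (X -> R) -> R} {H : ipspace (X -> R[i])}.
Hypothesis vfield : smooth_vector_field atlas v.
Hypothesis Hsmooth : forall f, H f -> smoothC atlas f.
Hypothesis HL : linear_subspace (carrier H).

Lemma derivation_linear (a : R[i]) f g : H f -> H g ->
  derivation v (a *: f + g) = a *: derivation v f + derivation v g.
Proof.
move=> Hf Hg; apply/funext => x; have [[vl _] _] := (vfield.1 x, vfield.2).
case: a => a b.
(* A complex multiple mixes real and imaginary parts into sums of three terms, while [vl] handles a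
   real multiple plus one function. This intermediate vector is smooth because it lies in H, so [vl]
   can be applied twice. *)
have Hbg : H ((0 +i* b) *: f + g) by case: HL => _; apply.
have [rf jf] := Hsmooth Hf; have [rg jg] := Hsmooth Hg.
have [rbg jbg] := Hsmooth Hbg.
have reE : (fun y => complex.Re (((0 +i* b) *: f + g) y)) =
    fun y => (- b) * complex.Im (f y) + complex.Re (g y).
  apply/funext => y; rewrite -[(_ + _) y]/((0 +i* b) * f y + g y).
  by case: (f y) => p q; case: (g y) => p' q' /=; ring.
have imE : (fun y => complex.Im (((0 +i* b) *: f + g) y)) =
    fun y => b * complex.Re (f y) + complex.Im (g y).
  apply/funext => y; rewrite -[(_ + _) y]/((0 +i* b) * f y + g y).
  by case: (f y) => p q; case: (g y) => p' q' /=; ring.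
have reE' : (fun y => complex.Re (((a +i* b) *: f + g) y)) =
    fun y => a * complex.Re (f y) + complex.Re (((0 +i* b) *: f + g) y).
  apply/funext => y; rewrite -[((a +i* b) *: f + g) y]/((a +i* b) * f y + g y).
  rewrite -[((0 +i* b) *: f + g) y]/((0 +i* b) * f y + g y).
  by case: (f y) => p q; case: (g y) => p' q' /=; ring.
have imE' : (fun y => complex.Im (((a +i* b) *: f + g) y)) =
    fun y => a * complex.Im (f y) + complex.Im (((0 +i* b) *: f + g) y).
  apply/funext => y; rewrite -[((a +i* b) *: f + g) y]/((a +i* b) * f y + g y).
  rewrite -[((0 +i* b) *: f + g) y]/((0 +i* b) * f y + g y).
  by case: (f y) => p q; case: (g y) => p' q' /=; ring.
rewrite -[RHS]/((a +i* b) * derivation v f x + derivation v g x) /derivation.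
rewrite reE' imE' !vl // reE imE !vl //=.
by congr (_ +i* _); ring.
Qed.

End Derivation.

Section Adjoint.
Context {R : realType} {E : lmodType R[i]} {H : ipspace E} {D domV : set E} {V : E -> E}.
Hypothesis HH : prehilbert H.
Hypothesis DD : linear_subspace D.
Hypothesis Ddense : hdense H D.
Hypothesis Ddom : D `<=` domV `&` adj_dom H domV V.
Local Notation Vstar := (adj H domV V).

Lemma adjP f : D f -> adjoint H (op_graph domV V) (f, Vstar f).
Proof.
by move=> /Ddom[_ dg]; exact: (xgetPex 0 dg).
Qed.

Lemma ip_adj f g : D f -> D g -> ip H f (V g) = ip H (Vstar f) g.
Proof. by move=> /adjP[_ _ fP] /Ddom[Dg _]; apply: (fP (g, V g)). Qed.

Hypothesis VD : forall f, D f -> D (V f).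
Hypothesis VsD : forall f, D f -> D (Vstar f).

(** [adj] is defined by choice, so linearity is not built in. It follows because both sides have the
    same inner product with every q in the dense subspace D. *)
Lemma adj_linear (a : R[i]) f g : D f -> D g ->
  Vstar (a *: f + g) = a *: Vstar f + Vstar g.
Proof.
move=> Df Dg; have DH q : D q -> H q by exact: hdense_sub.
have Dafg : D (a *: f + g) by case: DD => _; apply.
have Daf : D (a *: f) := subspaceZ DD a Df.
have HB := subspaceB (prehilbert_subspace HH).
have DR : D (a *: Vstar f + Vstar g) by case: DD => _; apply; exact: VsD.
apply/eqP; rewrite -subr_eq0; apply/eqP; apply: (hdense_ip_eq0 HH Ddense).
  by apply: HB; apply: DH => //; exact: VsD.
move=> q Dq; rewrite /rip ipBl //; try by apply: DH => //; exact: VsD.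
have hq := DH _ Dq; have hVq := DH _ (VD Dq).
have hf := DH _ Df; have hg := DH _ Dg.
have hVf := DH _ (VsD Df); have hVg := DH _ (VsD Dg).
have haVf : H (a *: Vstar f) := subspaceZ (prehilbert_subspace HH) a hVf.
rewrite -ip_adj // ipDl ?ipZl //; last exact: DH.
by rewrite ipDl ?ipZl // !ip_adj // subrr.
Qed.

End Adjoint.

Unset Implicit Arguments.

Theorem theorem10 (R : realType)
  (d : nat) (X : topologicalType) (atlas : set (@chart R d X))
  (v : X -> (X -> R) -> R) (Phi : R -> X -> X)
  (H : ipspace (X -> R[i])) (k : X -> X -> R[i])
  (Hinf : set (X -> R[i])) :
  smooth_manifold atlas ->
  smooth_vector_field atlas v ->
  flow_generated_by atlas v Phi ->
  (forall f, H f -> smoothC atlas f) ->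
  rkhs H k ->
  strictly_positive_definite k ->
  let V := derivation v in
  let domV := [set f | H f /\ H (V f)] in
  let Vstar := adj H domV V in
  continuous_compact_open H V ->
  linear_subspace Hinf ->
  hdense H Hinf ->
  Hinf `<=` domV `&` adj_dom H domV V ->
  (forall f, Hinf f -> Hinf (V f)) ->
  (forall f, Hinf f -> Hinf (Vstar f)) ->
  jointly_analytic H Hinf (fun i : 'I_2 => if i == ord0 then V else Vstar) ->
  let A := fun f => 2^-1 *: (V f - Vstar f) in
  let S := fun f => 2^-1 *: (V f + Vstar f) in
  let L := Lop H S A in
  let Lp := Lplus H S A in
  let H0 := alg_tensor Hinf in
  (essentially_skew_adjoint (ell2 H) H0 L /\
   essentially_skew_adjoint (ell2 H) H0 Lp) /\
  (forall (n m : nat) (f : X -> R[i]), (m < n)%N -> Hinf f ->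
     proj1 (iter m L (fib_embed n f)) = iter m V f /\
     proj1 (iter m Lp (fib_embed n f)) = iter m Vstar f).
Proof.
move=> _ vfield _ Hsmooth [HHilb _ _] _ V domV Vstar _ HinfL Hdense Hdom HV HVs ja A S L Lp H0.
have HH := is_hilbert_prehilbert HHilb.
have DH f : Hinf f -> H f := hdense_sub Hdense.
have Vlin (a : R[i]) f g : Hinf f -> Hinf g -> V (a *: f + g) = a *: V f + V g.
  by move=> Df Dg; apply: (derivation_linear vfield Hsmooth (prehilbert_subspace HH)); exact: DH.
have Vslin (a : R[i]) f g : Hinf f -> Hinf g -> Vstar (a *: f + g) = a *: Vstar f + Vstar g.
  exact: (adj_linear HH HinfL Hdense Hdom HV HVs).
have VVs f g : Hinf f -> Hinf g -> ip H f (V g) = ip H (Vstar f) g.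
  exact: (ip_adj Hdom).
have VsV f g : Hinf f -> Hinf g -> ip H f (Vstar g) = ip H (V f) g.
  exact: (ip_adjoint_sym HH Hdense HV HVs VVs).
have an f : Hinf f -> exists r c : R, [/\ 0 < r, 0 <= c & forall n,
    word_norm_sum (H := H) (V := V) (W := Vstar) n f <= c * n`!%:R * r ^+ n].
  exact: (jointly_analytic_bound ja).
have an' f : Hinf f -> exists r c : R, [/\ 0 < r, 0 <= c & forall n,
    word_norm_sum (H := H) (V := Vstar) (W := V) n f <= c * n`!%:R * r ^+ n].
  move=> /an[r [c [r0 c0 h]]]; exists r, c; split=> // n.
  by rewrite word_norm_sumC.
have LpE : Lp = Lop H (fun f => 2^-1 *: (Vstar f + V f)) (fun f => 2^-1 *: (Vstar f - V f)).
  exact: Lplus_swap.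
split; first split.
- exact: (Lop_essentially_skew_adjoint HH HinfL Hdense HV HVs Vlin Vslin VVs an).
- rewrite LpE.
  exact: (Lop_essentially_skew_adjoint HH HinfL Hdense HVs HV Vslin Vlin VsV an').
move=> n m f mn Df; rewrite LpE; split.
  exact: (proj1_iter_Lop HH HinfL Hdense HV HVs Vlin Vslin mn Df).
exact: (proj1_iter_Lop HH HinfL Hdense HVs HV Vslin Vlin mn Df).
Qed.
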